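(* Let $d\geq 2$ be an integer and let $k\in\{0,1,\ldots,\lfloor d/2\rfloor\}$. Let $M$ be a positive integer. For every polytope $P_M\subset B_d$ with at most $M$ $k$-dimensional faces, we have \[ \operatorname{vol}_d(B_d\setminus P_M)\;\geq\;\frac{1-e^{-1}}{2}\,\kappa_d\,\min\left\{1,\ \frac d2\left(\frac{\omega_d}{4\kappa_{d-1}}\right)^{\frac{2}{d-1}}M^{-\frac{2}{d-1}}\right\}. \]
   Context: $B_d=\{x\in\mathbb{R}^d:\|x\|_2\leq 1\}$ is the Euclidean unit ball centered at the origin, $\operatorname{vol}_d$ is $d$-dimensional volume, $\kappa_d=\operatorname{vol}_d(B_d)=\pi^{d/2}/\Gamma(\frac d2+1)$, and $\omega_d=\operatorname{vol}_{d-1}(\partial B_d)=d\kappa_d$ is the surface area of $B_d$. A polytope is the convex hull of finitely many points in $\mathbb{R}^d$. *)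

(* Defs.v *)
From HB Require Import structures.
From mathcomp Require Import all_boot all_order all_algebra.
From mathcomp Require Import all_classical all_reals all_analysis.

Set Implicit Arguments.
Unset Strict Implicit.
Unset Printing Implicit Defensive.

Import Order.TTheory GRing.Theory Num.Theory.

Local Open Scope classical_set_scope.
Local Open Scope ring_scope.

Section lebesgue_tuple.
Context {R : realType}.
Local Notation T := (measurableTypeR R).

Fixpoint lebesgue_tuple (d : nat) : set (d.-tuple T) -> \bar R :=
  match d with
  | 0 => \d_ [tuple]
  | n.+1 => pushforward (@lebesgue_measure R \x @lebesgue_tuple n)%E
              (fun p => [tuple of p.1 :: p.2])
  end.

Section step.
Variables (n : nat) (m : {sigma_finite_measure set (n.-tuple T) -> \bar R}).

Let tcons (p : T * n.-tuple T) : n.+1.-tuple T := [tuple of p.1 :: p.2].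
Let tuncons (t : n.+1.-tuple T) : T * n.-tuple T :=
  (thead t, [tuple of behead t]).

Let measurable_tcons : measurable_fun setT tcons.
Proof. exact: measurable_cons. Qed.

Let measurable_tuncons : measurable_fun setT tuncons.
Proof.
apply/measurable_fun_pairP; split; first exact: measurable_tnth.
exact: measurable_behead.
Qed.

Let push := pushforward (@lebesgue_measure R \x m)%E tcons.

Let push0 : push set0 = 0%E.
Proof. by rewrite /push /pushforward preimage_set0 measure0. Qed.

Let push_ge0 A : (0 <= push A)%E.
Proof. exact: measure_ge0. Qed.

Let push_sigma_additive : semi_sigma_additive push.
Proof.
move=> F mF tF mUF; rewrite /push /pushforward preimage_bigcup.
apply: measure_semi_sigma_additive.
- by move=> i; rewrite -[X in measurable X]setTI; exact: measurable_tcons.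
- apply/trivIsetP => /= i j _ _ ij; rewrite -preimage_setI.
  by move/trivIsetP : tF => /(_ _ _ _ _ ij) ->//; rewrite preimage_set0.
- rewrite -preimage_bigcup -[X in measurable X]setTI.
  exact: measurable_tcons.
Qed.

#[local] HB.instance Definition _ :=
  isMeasure.Build _ _ _ push push0 push_ge0 push_sigma_additive.

Let push_sigma_finite : sigma_finite setT push.
Proof.
have /sigma_finiteP[F [FT ndF Foo]] := sigma_finiteT (@lebesgue_measure R).
have /sigma_finiteP[G [GT ndG Goo]] := sigma_finiteT m.
exists (fun i => tuncons @^-1` (F i `*` G i)).
  rewrite -preimage_bigcup; apply/esym/seteqP; split => // t _.
  have : setT (tuncons t).1 by [].
  have : setT (tuncons t).2 by [].
  rewrite {1}GT {1}FT => -[j _ Gj] [i _ Fi].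
  exists (maxn i j) => //; split.
    by move: Fi; exact/subsetPset/ndF/leq_maxl.
  by move: Gj; exact/subsetPset/ndG/leq_maxr.
move=> i; have [mFi Fioo] := Foo i; have [mGi Gioo] := Goo i; split.
  rewrite -[X in measurable X]setTI; apply: measurable_tuncons => //.
  exact: measurableX.
rewrite /push /pushforward (_ : _ @^-1` _ = F i `*` G i); last first.
  by apply/seteqP; split => -[x t] /=; rewrite theadE /=;
    rewrite (_ : [tuple of _] = t)//; exact: val_inj.
by rewrite product_measure1E// lte_mul_pinfty// ge0_fin_numE.
Qed.

#[local] HB.instance Definition _ :=
  Measure_isSigmaFinite.Build _ _ _ push push_sigma_finite.

Lemma lebesgue_tuple_step :
  {m' : {sigma_finite_measure set (n.+1.-tuple T) -> \bar R} |
   m' = pushforward (@lebesgue_measure R \x m)%E tcons :> (set _ -> _)}.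
Proof. by exists push. Qed.

End step.

Lemma lebesgue_tuple_measure (d : nat) :
  {m : {sigma_finite_measure set (d.-tuple T) -> \bar R} |
   m = @lebesgue_tuple d :> (set _ -> _)}.
Proof.
elim: d => [|n [m mE]]; first by exists (\d_ ([tuple] : 0.-tuple T)).
by have [m' m'E] := lebesgue_tuple_step m; exists m'; rewrite m'E mE.
Qed.

Variable d : nat.
Local Notation leb := (@lebesgue_tuple d).

Let leb0 : leb set0 = 0%E.
Proof. by have [m <-] := lebesgue_tuple_measure d. Qed.

Let leb_ge0 A : (0 <= leb A)%E.
Proof. by have [m <-] := lebesgue_tuple_measure d. Qed.

Let leb_sigma_additive : semi_sigma_additive leb.
Proof.
by have [m <-] := lebesgue_tuple_measure d; exact: measure_semi_sigma_additive.
Qed.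

HB.instance Definition _ :=
  isMeasure.Build _ _ _ leb leb0 leb_ge0 leb_sigma_additive.

Let leb_sigma_finite : sigma_finite setT leb.
Proof. by have [m <-] := lebesgue_tuple_measure d; exact: sigma_finiteT. Qed.

HB.instance Definition _ :=
  Measure_isSigmaFinite.Build _ _ _ leb leb_sigma_finite.

End lebesgue_tuple.
Arguments lebesgue_tuple : clear implicits.

Lemma lebesgue_tuple_box (R : realType) (d : nat)
    (A : 'I_d -> set (measurableTypeR R)) : (forall i, measurable (A i)) ->
  lebesgue_tuple R d [set t | forall i, A i (tnth t i)] =
  (\prod_(i < d) lebesgue_measure (A i))%E.
Proof.
elim: d A => [|n IHn] A mA.
  by rewrite big_ord0 /= diracE mem_set// => -[].
rewrite big_ord_recl -IHn//= /pushforward -product_measure1E//; last first.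
  rewrite (_ : mkset _ = \bigcap_(i in [set: 'I_n])
      ((@tnth n (measurableTypeR R))^~ i @^-1` A (lift ord0 i))); last first.
    by apply/seteqP; split => [t tA i _|t tA i]; [exact: tA|exact: (tA i)].
  apply: fin_bigcap_measurable => // i _.
  by rewrite -[X in measurable X]setTI; exact: measurable_tnth.
congr (_ _); apply/seteqP; split => -[x t] /=.
  move=> tA; split; first exact: (tA ord0).
  by move=> i; have := tA (lift ord0 i); rewrite tnthS.
move=> [xA tA] i; have [j ->|->//] := unliftP ord0 i.
by rewrite tnthS.
Qed.

Section euclidean_geometry.
Context {R : realType}.
Variable d : nat.
Local Notation E := 'rV[R]_d.
Implicit Types (x y c : E) (S P F A : set E).

Definition vol A : \bar R :=
  lebesgue_tuple R d [set t | A (\row_i tnth t i)].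

Definition dot x y : R := \sum_i x 0 i * y 0 i.

(* The library's norm on row vectors is the sup norm. *)
Definition enorm x : R := Num.sqrt (dot x x).

Definition unit_ball : set E := [set x | enorm x <= 1].

Definition conv_hull S : set E := smallest (@convex_set R E) S.

Definition polytope P := exists2 S, finite_set S & P = conv_hull S.

Definition affine_set A :=
  forall x y (t : R), A x -> A y -> A ((1 - t) *: x + t *: y).

Definition aff_hull S : set E := smallest affine_set S.

(* The empty set has no dimension in this sense, hence is never a k-face. *)
Definition has_dim A (k : nat) :=
  exists x (U : {vspace E}),
    aff_hull A = [set x + u | u in [set` U]] /\ \dim U = k.

(* c = 0 gives the improper faces P and set0. *)
Definition face P F :=
  exists c (b : R), (forall x, P x -> dot c x <= b) /\
    F = P `&` [set x | dot c x = b].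

Definition faces (k : nat) P : set (set E) :=
  [set F | face P F /\ has_dim F k].

End euclidean_geometry.
Arguments unit_ball {R} d.

Definition kappa (R : realType) (d : nat) : R :=
  fine (vol (@unit_ball R d)).

(* The surface area of the unit ball, through the identity
   vol_(d-1)(boundary of B_d) = d * kappa_d. *)
Definition omega (R : realType) (d : nat) : R := d%:R * kappa R d.

(* Main.v *)
Require Import Defs.
From mathcomp Require Import all_boot all_order all_algebra.
From mathcomp Require Import all_classical all_reals all_analysis.
From mathcomp Require Import measurable_realfun.
From mathcomp Require Import ring lra zify.

(* Let d = n + 1, let t be the smaller of 1/d and
   (omega_d / (4 kappa_n))^(2/n) M^(-2/n) / 2, and let r = 1 - t.

   If x in P has norm > r, then some vertex v of P has <v, x> >= |x|^2 > r |x|,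
   so x lies in the sector of the unit ball of directions at cosine >= r from v.
   A sector sits inside a cone topped by a cylinder over a ball of radius
   sqrt (1 - r^2), and so has volume <= (2 kappa_n / d) (1 - r^2)^(n/2).  If P
   has at most M vertices, the sectors fill at most half of the unit ball by the
   choice of t; since the rest D is a union of radii, the part of D of norm > r
   misses P and has volume (1 - r^d) vol D >= (1 - r^d) kappa_d / 2.  Finally
   r^d <= exp (- d t), and exp is convex.

   It remains to see that f_0 <= f_k for a d-polytope and k <= d/2.  Fix a linear
   form h which is injective on the vertices.  Each k-face has one lowest and one
   highest vertex, so it is enough that each vertex v is extremal (lowest or
   highest) at least twice.  Let N be the normal cone at v and let c be a vertex
   of the polyhedron N :&: (N + h).  The faces F and G exposed at v by c and
   c - h lie above and below v, and dim F + dim G >= d because the constraints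
   tight at c span.  Then F and G have enough k-faces through v. *)

Set Implicit Arguments.
Unset Strict Implicit.
Unset Printing Implicit Defensive.

Import Order.TTheory GRing.Theory Num.Theory numFieldNormedType.Exports.

Local Open Scope classical_set_scope.
Local Open Scope ring_scope.

(** * Inner product, polyhedra and faces at a vertex *)

Section dot_product.
Context {R : realType} {d : nat}.
Implicit Types x y z : 'rV[R]_d.

Lemma dotC x y : dot x y = dot y x.
Proof. by apply: eq_bigr => i _; rewrite mulrC. Qed.

Lemma dotDl x y z : dot (x + y) z = dot x z + dot y z.
Proof. by rewrite -big_split; apply: eq_bigr => i _; rewrite mxE mulrDl. Qed.

Lemma dotZl (a : R) x y : dot (a *: x) y = a * dot x y.
Proof. by rewrite [RHS]mulr_sumr; apply: eq_bigr => i _; rewrite mxE mulrA. Qed.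

Lemma dotDr x y z : dot x (y + z) = dot x y + dot x z.
Proof. by rewrite dotC dotDl !(dotC x). Qed.

Lemma dotZr (a : R) x y : dot x (a *: y) = a * dot x y.
Proof. by rewrite dotC dotZl (dotC x). Qed.

Lemma dotNl x y : dot (- x) y = - dot x y.
Proof. by rewrite -scaleN1r dotZl mulN1r. Qed.

Lemma dotNr x y : dot x (- y) = - dot x y.
Proof. by rewrite dotC dotNl dotC. Qed.

Lemma dotBl x y z : dot (x - y) z = dot x z - dot y z.
Proof. by rewrite dotDl dotNl. Qed.

Lemma dotBr x y z : dot x (y - z) = dot x y - dot x z.
Proof. by rewrite dotDr dotNr. Qed.

Lemma dot0r x : dot x 0 = 0.
Proof. by rewrite -(scale0r x) dotZr mul0r. Qed.

Lemma dot0l x : dot 0 x = 0.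
Proof. by rewrite dotC dot0r. Qed.

Lemma dot_ge0 x : 0 <= dot x x.
Proof. by apply: sumr_ge0 => i _; rewrite -expr2 sqr_ge0. Qed.

Lemma dot_eq0 x : (dot x x == 0) = (x == 0).
Proof.
apply/idP/eqP => [|->]; last by rewrite dot0r.
rewrite psumr_eq0 => [/allP x0|i _]; last by rewrite -expr2 sqr_ge0.
apply/rowP => i; rewrite mxE; apply/eqP.
by have := x0 i (mem_index_enum _); rewrite -expr2 sqrf_eq0.
Qed.

Lemma dot_sumr (I : finType) (A : pred I) x (f : I -> 'rV[R]_d) :
  dot x (\sum_(i | A i) f i) = \sum_(i | A i) dot x (f i).
Proof. by apply: (big_morph (dot x)); [exact: dotDr|exact: dot0r]. Qed.

Lemma linear_dot (f : 'rV[R]_d -> R) : linear f -> exists g, forall x, f x = dot g x.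
Proof.
move=> lf.
have f0 : f 0 = 0 by have := lf 1 0 0; rewrite !scale1r addr0; lra.
have fZ a x : f (a *: x) = a * f x by have := lf a x 0; rewrite !addr0 f0 addr0.
have fD x y : f (x + y) = f x + f y by have := lf 1 x y; rewrite !scale1r.
exists (\row_i f (delta_mx 0 i)) => x.
rewrite {1}(row_sum_delta x) (big_morph f fD f0).
by apply: eq_bigr => i _; rewrite fZ mxE mulrC.
Qed.

(** [x - projv U x] is nonzero; one of its nonzero coordinates, as a linear form in x, kills U but
    not x. *)
Lemma exists_normal (U : {vspace 'rV[R]_d}) x : x \notin U ->
  exists g, (forall u, u \in U -> dot g u = 0) /\ 0 < dot g x.
Proof.
move=> xU.
suff [g [gU gx]] : exists g, (forall u, u \in U -> dot g u = 0) /\ dot g x != 0.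
  have [gx0|gx0] := ltP 0 (dot g x); first by exists g.
  exists (- g); split=> [u /gU|]; first by rewrite dotNl => ->; rewrite oppr0.
  by rewrite dotNl oppr_gt0 lt_neqAle gx.
have : x - projv U x != 0.
  by apply: contra xU; rewrite subr_eq0 => /eqP ->; exact: memv_proj.
case/rV0Pn => j xj.
have lf : linear (fun y : 'rV[R]_d => (y - projv U y) 0 j).
  move=> a y z; rewrite linearP /= !mxE. rewrite /GRing.scale /=; lra.
have [g fg] := linear_dot lf.
exists g; split=> [u uU|]; rewrite -fg //.
by rewrite projv_id // subrr mxE.
Qed.

End dot_product.

(** Where p < 0 a large multiple of p outweighs q; where p = 0 the sign of q decides. For linear
    forms this makes a face of a face a face. *)
Lemma dominating_scale {R : realType} (T : finType) (p q : T -> R) :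
  (forall i, p i <= 0) -> (forall i, p i = 0 -> q i <= 0) ->
  exists K, [/\ 0 < K, forall i, K * p i + q i <= 0 &
    forall i, (K * p i + q i == 0) = (p i == 0) && (q i == 0)].
Proof.
move=> p0 q0; pose K := 1 + \sum_i `|q i| / `|p i|.
have K0 : 0 < K.
  by rewrite ltr_pwDl // sumr_ge0.
have Kp i : p i < 0 -> K * p i + q i < 0.
  move=> pi0; have : `|q i| / `|p i| < K.
    by rewrite /K (bigD1 i) //= addrCA ltrDl ltr_pwDl // sumr_ge0 //.
  rewrite ltr_pdivrMr ?normr_gt0 ?lt_eqF // (ltr0_norm pi0).
  by have := ler_norm (q i); lra.
exists K; split=> // i; have := p0 i; rewrite le_eqVlt => /predU1P[pi0|pi0].
- by rewrite pi0 mulr0 add0r q0.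
- exact/ltW/Kp.
- by rewrite pi0 mulr0 add0r eqxx.
- by rewrite (lt_eqF pi0) (lt_eqF (Kp i pi0)).
Qed.

(** * Basic solutions of systems of linear inequalities *)

Section basic_solution.
Context {R : realType} {d : nat} {T : finType}.
Variables (t : T -> 'rV[R]_d) (a : T -> R).

Let tight c : {vspace 'rV[R]_d} := (\sum_(j | dot c (t j) == a j) <[t j]>)%VS.

Lemma mem_sumv_line (A : pred T) i : A i -> t i \in (\sum_(j | A j) <[t j]>)%VS.
Proof.
by move=> Ai; apply: (subvP (sumv_sup i Ai (subvv _))); exact: memv_line.
Qed.

Lemma dot_sumv_line (A : pred T) g u : (forall i, A i -> dot g (t i) = 0) ->
  u \in (\sum_(j | A j) <[t j]>)%VS -> dot g u = 0.
Proof.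
move=> gA /memv_sumP[f ft ->]; rewrite dot_sumr big1 // => i Ai.
by have /vlineP[k ->] := ft i Ai; rewrite dotZr gA // mulr0.
Qed.

(* Slide c along a direction orthogonal to the tight constraints until a new
   one, outside of their span, becomes tight. *)
Lemma exists_basic_solution c : (forall i, dot c (t i) <= a i) ->
  exists c', (forall i, dot c' (t i) <= a i) /\ forall i, t i \in tight c'.
Proof.
have [n] := ubnP (\dim {:'rV[R]_d} - \dim (tight c)); elim: n c => // n IHn c.
rewrite ltnS => cn ca.
have [/forallP cT|] := boolP [forall i, t i \in tight c]; first by exists c.
rewrite negb_forall => /existsP[i0 i0c].
have [g [gc gi0]] := exists_normal i0c.
(* Sliding along g, a constraint on which g is positive becomes tight at [ratio i]; j is the first
   to do so, and i0 shows that there is one. *)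
pose ratio i := (a i - dot c (t i)) / dot g (t i).
pose j := [arg min_(i < i0 | 0 < dot g (t i)) ratio i]%O.
have [gj jmin] : 0 < dot g (t j) /\
    forall i, 0 < dot g (t i) -> ratio j <= ratio i.
  by rewrite /j; case: arg_minP.
have rj0 : 0 <= ratio j by rewrite divr_ge0 ?subr_ge0 // ltW.
pose c' := c + ratio j *: g.
have c'E i : dot c' (t i) = dot c (t i) + ratio j * dot g (t i).
  by rewrite dotDl dotZl.
have c'j : dot c' (t j) == a j by rewrite c'E /ratio (mulfVK (lt0r_neq0 gj)) addrC subrK.
apply: (IHn c') => [|i].
  apply: leq_trans cn; apply: ltn_sub2l.
    rewrite ltn_neqAle dimvS ?subvf // andbT.
    by apply: contra i0c => /eqP dc; rewrite (eqP (_ : tight c == fullv))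
      ?memvf // eqEdim subvf dc leqnn.
  rewrite ltn_neqAle; have cc' : (tight c <= tight c')%VS.
    apply/subv_sumP => i ci; rewrite -memvE; apply: mem_sumv_line.
    by rewrite c'E gc ?mulr0 ?addr0 //; exact: mem_sumv_line.
  rewrite dimvS // andbT; apply/negP => /eqP dcc'.
  have cE : tight c = tight c' by apply/eqP; rewrite eqEdim cc' dcc' leqnn.
  have : t j \in tight c by rewrite cE; exact: mem_sumv_line.
  by move/gc; move: gj => /[swap] ->; rewrite ltxx.
rewrite c'E; have [gi|gi] := ltP 0 (dot g (t i)).
  by have := jmin i gi; rewrite [X in _ <= X -> _]/ratio ler_pdivlMr //; lra.
by have := ca i; have := mulr_ge0_le0 rj0 gi; lra.
Qed.

End basic_solution.

(** * Faces at a vertex of a point configuration *)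

Section point_configuration.
Context {R : realType} {d : nat} {T : finType}.
Variable s : T -> 'rV[R]_d.

(** For v in A, the direction space of the affine hull of the points of A. *)
Definition face_span (v : T) (A : {set T}) : {vspace 'rV[R]_d} :=
  (\sum_(i in A) <[s i - s v]>)%VS.

(* A indexes the points lying on a face of the convex hull of s which contains
   s v. *)
Definition face_at (v : T) (A : {set T}) := exists c,
  (forall i, dot c (s i - s v) <= 0) /\
  A = [set i | dot c (s i - s v) == 0]%SET.

Definition exposed (v : T) :=
  exists e, forall i, i != v -> dot e (s i - s v) < 0.

Lemma mem_face_at v A : face_at v A -> v \in A.
Proof. by move=> [c [_ ->]]; rewrite inE subrr dot0r. Qed.

Section at_vertex.
Variables (v : T) (e : 'rV[R]_d).
Hypothesis ev : forall i, i != v -> dot e (s i - s v) < 0.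

Let e_le0 i : dot e (s i - s v) <= 0.
Proof. by have [->|/ev/ltW//] := eqVneq i v; rewrite subrr dot0r. Qed.

(** B is cut out by a basic solution e' of the system e' <= 0 on A and e' <= -1 at i1, in directions
    from [s v]. The tight vectors span [face_span v A] and, apart from zeros and i1, come from B, so
    the dimension drops by at most one. It does drop, as e' vanishes on [face_span v B] but not at
    i1. *)
Lemma exists_facet_avoiding A i1 : face_at v A -> i1 \in A -> i1 != v ->
  exists B : {set T}, [/\ B \subset A, face_at v B, i1 \notin B &
    \dim (face_span v A) = (\dim (face_span v B)).+1].
Proof.
move=> [c [c0 AE]] Ai1 i1v.
(* Off A the constraint is 0 <= 0, which adds nothing to the span of the tight vectors. *)
pose t i := if i \in A then s i - s v else 0.
pose a i : R := if i == i1 then - 1 else 0.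
pose m := dot e (s i1 - s v); have m0 : m < 0 by exact: ev.
(* This multiple of e takes the value -1 at i1, hence is feasible. *)
have [|e' [e'a e't]] := @exists_basic_solution R d T t a ((- m^-1) *: e).
  move=> i; rewrite dotZl /a /t; have [->|ii1] := eqVneq i i1.
    by rewrite Ai1 -/m mulNr mulVf ?lt_eqF.
  case: ifP => _; last by rewrite dot0r mulr0.
  by rewrite mulr_ge0_le0 // oppr_ge0 invr_le0 ltW.
have e'i1 : dot e' (s i1 - s v) <= - 1.
  by have := e'a i1; rewrite /t /a Ai1 eqxx.
have e'0 i : i \in A -> dot e' (s i - s v) <= 0.
  by move=> Ai; have := e'a i; rewrite /t /a Ai; case: ifP => _; lra.
pose B := [set i in A | dot e' (s i - s v) == 0]%SET.
have BA : B \subset A by apply/fintype.subsetP => i; rewrite inE => /andP[].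
exists B; split=> //.
(* Adding e' to a large multiple of c exposes B among all points, not only among those of A. *)
- have [i|i|K [K0 K1 K2]] := @dominating_scale R T
    (fun i => dot c (s i - s v)) (fun i => dot e' (s i - s v)).
  + exact: c0.
  + by move=> /eqP ci; rewrite e'0 // AE inE.
  + exists (K *: c + e'); split=> [i|]; first by rewrite dotDl dotZl.
    by apply/setP => i; rewrite !inE AE inE dotDl dotZl K2.
- by rewrite inE Ai1 /= lt_eqF //; lra.
have spBA : (face_span v B <= face_span v A)%VS.
  apply/subv_sumP => i Bi; rewrite -memvE.
  by apply: (mem_sumv_line (fun i => s i - s v)); exact: (fintype.subsetP BA).
apply/eqP; rewrite eqn_leq; apply/andP; split.
  have AB1 : (face_span v A <= face_span v B + <[s i1 - s v]>)%VS.
    apply/subv_sumP => i Ai; rewrite -memvE.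
    have := e't i; rewrite {1}/t Ai; apply: subvP.
    apply/subv_sumP => j; rewrite /t /a; case: ifP => Aj ej; last first.
      by rewrite -memvE mem0v.
    have [->|ji1] := eqVneq j i1; first exact: addvSr.
    apply: subv_trans (addvSl _ _); rewrite -memvE.
    apply: (mem_sumv_line (fun i => s i - s v)).
    by move: ej; rewrite (negPf ji1) inE Aj.
  apply: leq_trans (dimvS AB1) _; apply: leq_trans (dimv_add_leqif _ _).1 _.
  by rewrite -[leqRHS]addn1 leq_add2l dim_vline; case: (_ != _).
rewrite ltnNge; apply/negP => dAB.
have : s i1 - s v \in face_span v B.
  have -> : face_span v B = face_span v A.
    by apply/eqP; rewrite eqEdim spBA.
  exact: (mem_sumv_line (fun i => s i - s v)).
move/(@dot_sumv_line R d T _ _ e') => H.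
have : dot e' (s i1 - s v) = 0 by apply: H => i; rewrite inE => /andP[_ /eqP].
by lra.
Qed.

Lemma exists_other_point A : (0 < \dim (face_span v A))%N ->
  exists2 i, i \in A & i != v.
Proof.
move=> dA; apply/exists_inP; apply: contraLR dA.
rewrite negb_exists_in => /forall_inP Av.
rewrite -eqn0Ngt dimv_eq0 -subv0; apply/subv_sumP => i /Av.
by rewrite negbK => /eqP ->; rewrite subrr -memvE mem0v.
Qed.

Lemma exists_subface k A : face_at v A -> (k <= \dim (face_span v A))%N ->
  exists B : {set T}, [/\ B \subset A, face_at v B & \dim (face_span v B) = k].
Proof.
move En : (\dim (face_span v A)) => n; elim: n A En => [|n IHn] A An fA.
  by rewrite leqn0 => /eqP ->; exists A.
rewrite leq_eqVlt => /predU1P[->|kn]; first by exists A.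
have [i Ai iv] : exists2 i, i \in A & i != v.
  by apply: exists_other_point; rewrite An.
have [B [BA fB _]] := exists_facet_avoiding fA Ai iv.
rewrite An => -[nB]; have [C [CB fC Ck]] := IHn B (esym nB) fB kn.
by exists C; split=> //; exact: fintype.subset_trans CB BA.
Qed.

(** In a face D of dimension k + 1 take a facet B, then a point j of B other than v, which exists as
    k > 0, and a facet C avoiding j. *)
Lemma exists_two_subfaces k A : face_at v A ->
  (0 < k < \dim (face_span v A))%N ->
  exists B C : {set T}, [/\ B \subset A /\ C \subset A, B != C,
    face_at v B /\ \dim (face_span v B) = k &
    face_at v C /\ \dim (face_span v C) = k].
Proof.
move=> fA /andP[k0 kA]; have [D [DA fD Dk]] := exists_subface fA kA.
have [i Di iv] : exists2 i, i \in D & i != v.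
  by apply: exists_other_point; rewrite Dk.
have [B [BD fB _ Bk]] := exists_facet_avoiding fD Di iv.
have {}Bk : \dim (face_span v B) = k by apply: succn_inj; rewrite -Bk Dk.
have [j Bj jv] : exists2 j, j \in B & j != v.
  by apply: exists_other_point; rewrite Bk.
have [C [CD fC jC Ck]] := exists_facet_avoiding fD (fintype.subsetP BD _ Bj) jv.
have {}Ck : \dim (face_span v C) = k by apply: succn_inj; rewrite -Ck Dk.
exists B, C; split=> //.
  by split; [exact: fintype.subset_trans BD DA|exact: fintype.subset_trans CD DA].
by apply: contra jC => /eqP <-.
Qed.

(* A vertex c of the polyhedron N :&: (N + h), with N the normal cone at s v:
   the points where c (resp. c - h) vanishes lie above (resp. below) s v. *)
Lemma exists_up_down_faces (h : 'rV[R]_d) : face_span v [set: T]%SET = fullv ->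
  exists F G : {set T}, [/\ face_at v F /\ face_at v G,
    forall i, i \in F -> 0 <= dot h (s i - s v),
    forall i, i \in G -> dot h (s i - s v) <= 0 &
    (d <= \dim (face_span v F) + \dim (face_span v G))%N].
Proof.
(* The bound [a i] merges the constraints that c and c - h are both <= 0 on [t i]. A large multiple
   of e is feasible, since e is negative away from v. *)
move=> vT; pose t i := s i - s v; pose a i := Num.min 0 (dot h (t i)).
have [i||K [K0 K1 _]] := @dominating_scale R T
    (fun i => dot e (t i)) (fun i => - dot h (t i)).
- exact: e_le0.
- move=> i; have [->|/ev] := eqVneq i v; last by move=> + ei; rewrite ei ltxx.
  by rewrite /t subrr !dot0r oppr0.
have [|c [ca ct]] := @exists_basic_solution R d T t a (K *: e).
  move=> i; rewrite /a le_min dotZl; apply/andP; split.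
    by rewrite pmulr_rle0 //; exact: e_le0.
  by have := K1 i; lra.
have c0 i : dot c (t i) <= 0 by have := ca i; rewrite le_min => /andP[].
have ch i : dot (c - h) (t i) <= 0.
  by have := ca i; rewrite le_min dotBl => /andP[_]; lra.
exists [set i | dot c (t i) == 0]%SET, [set i | dot (c - h) (t i) == 0]%SET.
split.
- by split; [exists c|exists (c - h)].
- by move=> i; rewrite inE => /eqP c0i; have := ch i; rewrite dotBl c0i /t; lra.
- by move=> i; rewrite inE dotBl => /eqP; have := c0 i; rewrite /t; lra.
apply: leq_trans (dimv_add_leqif _ _).1; rewrite -[leqLHS](_ : \dim {:'rV[R]_d} = d);
  last by rewrite dimvf /dim /= mul1n.
apply: dimvS; rewrite -vT; apply/subv_sumP => i _; rewrite -memvE.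
apply: subvP (ct i); apply/subv_sumP => j; rewrite -memvE {1}/a => cj.
(* A tight constraint is tight for c or for c - h, whichever attains the minimum. *)
have [h0|h0] := leP 0 (dot h (t j)).
  apply: (subvP (addvSl _ _)); apply: (mem_sumv_line t).
  by move: cj; rewrite inE min_l.
apply: (subvP (addvSr _ _)); apply: (mem_sumv_line t).
by move: cj; rewrite inE dotBl subr_eq0 min_r // ltW.
Qed.

End at_vertex.

End point_configuration.

(** * Counting faces *)

Section face_numbers.
Context {R : realType} {d : nat} {T : finType}.
Variable s : T -> 'rV[R]_d.

(** Double counting between V and the labelled faces in K x bool: each v is extremal in at least two
    of them, and each has at most one such v, since h is injective. *)
Lemma card_exposed_le (h : 'rV[R]_d) k (V : {set T}) (K : {set {set T}}) :
  (2 <= d)%N -> (k <= d./2)%N -> injective (fun i => dot h (s i)) ->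
  (forall v, v \in V -> exposed s v) ->
  (forall v, v \in V -> face_span s v [set: T]%SET = fullv) ->
  (forall v A, v \in V -> face_at s v A -> \dim (face_span s v A) = k ->
    A \in K) ->
  (#|V| <= #|K|)%N.
Proof.
move=> d2 kd hinj Vexp Vfull VK.
(* The label [true] asks v to be lowest on the face, [false] to be highest. *)
pose extremal v (p : {set T} * bool) :=
  [forall i in p.1, if p.2 then dot h (s v) <= dot h (s i)
                    else dot h (s i) <= dot h (s v)].
pose X v := [set p | [&& p.1 \in K, v \in p.1 & extremal v p]]%SET.
have X2 v : v \in V -> (1 < #|X v|)%N.
  move=> Vv; have [e ev] := Vexp v Vv.
  have [F [G [[fF fG] Fh Gh dFG]]] := exists_up_down_faces ev h (Vfull v Vv).
  have XF (B : {set T}) : B \subset F -> face_at s v B -> \dim (face_span s v B) = k ->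
      (B, true) \in X v.
    move=> BF fB Bk; rewrite inE /= (VK v) // (mem_face_at fB).
    apply/forall_inP => i /= /(fintype.subsetP BF) /Fh.
    by rewrite dotBr subr_ge0.
  have XG (B : {set T}) : B \subset G -> face_at s v B -> \dim (face_span s v B) = k ->
      (B, false) \in X v.
    move=> BG fB Bk; rewrite inE /= (VK v) // (mem_face_at fB).
    apply/forall_inP => i /= /(fintype.subsetP BG) /Gh.
    by rewrite dotBr subr_le0.
  have kkd : (k + k <= d)%N by rewrite addnn; move: kd; lia.
  apply/card_gt1P.
  (* If dim F < k, then k > 0 and dim G > k, so G alone supplies two k-faces; the next case is
     symmetric. *)
  have [kF|Fk] := leqP k (\dim (face_span s v F)); last first.
    have [|B [C [[BG CG] BC [fB Bk] [fC Ck]]]] := exists_two_subfaces ev fG (k := k).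
      by apply/andP; split; lia.
    exists (B, false), (C, false); split; [exact: XG|exact: XG|].
    by apply: contra BC => /eqP[->].
  have [kG|Gk] := leqP k (\dim (face_span s v G)); last first.
    have [|B [C [[BF CF] BC [fB Bk] [fC Ck]]]] := exists_two_subfaces ev fF (k := k).
      by apply/andP; split; lia.
    exists (B, true), (C, true); split; [exact: XF|exact: XF|].
    by apply: contra BC => /eqP[->].
  (* The labels keep the two pairs distinct even if B = C, as happens for k = 0. *)
  have [B [BF fB Bk]] := exists_subface ev fF kF.
  have [C [CG fC Ck]] := exists_subface ev fG kG.
  by exists (B, true), (C, false); split; [exact: XF|exact: XG|rewrite xpair_eqE andbF].
have X_inj p v w : p \in X v -> p \in X w -> v = w.
  rewrite !inE => /and3P[_ vp /forall_inP pv] /and3P[_ wp /forall_inP pw].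
  by apply: hinj; apply/eqP; rewrite eq_le; move: (pv w wp) (pw v vp);
    case: p.2 => -> ->.
rewrite -(leq_pmul2r (isT : 0 < 2)%N) -{2}card_bool -cardsT -cardsX.
have /leq_trans -> // : (#|V| * 2 <= \sum_(v in V) #|X v|)%N.
  by rewrite -sum_nat_const; apply: leq_sum => v /X2.
under eq_bigr do rewrite -sum1_card.
rewrite (exchange_big_dep (mem (finset.setX K [set: bool]%SET))) /=; last first.
  by move=> v p _; rewrite !inE andbT => /and3P[].
rewrite -sum1_card; apply: leq_sum => p _; rewrite sum1_card.
by apply/card_le1_eqP => v w /andP[_ vp] /andP[_ wp]; exact: X_inj wp vp.
Qed.

(** Ties between maximizers of x are broken by h; a large multiple of x plus h then peaks at v
    only. *)
Lemma exists_exposed_max (h x : 'rV[R]_d) (i0 : T) :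
  injective (fun i => dot h (s i)) ->
  exists v, exposed s v /\ forall i, dot x (s i) <= dot x (s v).
Proof.
move=> hinj.
pose v0 := [arg max_(i > i0) dot x (s i)]%O.
have v0max i : dot x (s i) <= dot x (s v0).
  by rewrite /v0; case: arg_maxP => // j _; exact.
pose v := [arg max_(i > v0 | dot x (s i) == dot x (s v0)) dot h (s i)]%O.
have [/eqP vv0 vmax] : dot x (s v) == dot x (s v0) /\
    forall i, dot x (s i) == dot x (s v0) -> dot h (s i) <= dot h (s v).
  by rewrite /v; case: arg_maxP.
exists v; split=> [|i]; last by rewrite vv0.
have [i|i /eqP|K [_ K1 K2]] := @dominating_scale R T
    (fun i => dot x (s i - s v)) (fun i => dot h (s i - s v)).
- by rewrite dotBr subr_le0 vv0.
- by rewrite !dotBr subr_eq0 subr_le0 vv0; exact: vmax.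
exists (K *: x + h) => i iv; rewrite dotDl dotZl lt_neqAle K1 K2 andbT.
apply: contra iv => /andP[_]; rewrite dotBr subr_eq0 => /eqP hi.
by apply/eqP; exact: hinj.
Qed.

Lemma convex_set_line (A : set 'rV[R]_d) :
  (forall x y (t : R), 0 < t -> t < 1 -> A x -> A y -> A (t *: x + (1 - t) *: y)) ->
  convex_set A.
Proof.
move=> cA; apply/convex_setW => x y /set_mem xA /set_mem yA k k0 k1.
by apply/mem_set; exact: cA.
Qed.

(** This turns [\dim (face_span s v A)] into the dimension of a face in the sense of [has_dim]. *)
Lemma aff_hull_face (v : T) (c : 'rV[R]_d)
    (A := [set i | dot c (s i - s v) == 0]%SET)
    (F := conv_hull (range s) `&` [set x | dot c x = dot c (s v)]) :
  (forall i, dot c (s i - s v) <= 0) ->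
  aff_hull F = [set s v + u | u in [set` face_span s v A]].
Proof.
move=> c0; apply/seteqP; split.
  apply: smallest_sub.
    move=> x y t [u uA <-] [w wA <-]; exists ((1 - t) *: u + t *: w).
      by rewrite /= memvD // memvZ.
    rewrite !scalerDr addrACA -scalerDl subrK scale1r //.
  move=> x [Px cx]; exists (x - s v); last by rewrite addrC subrK.
  (* H is convex: a proper convex combination on the hyperplane has both ends on it, as H does not
     rise above it. *)
  pose H := [set x | dot c x <= dot c (s v) /\
    (dot c x = dot c (s v) -> x - s v \in face_span s v A)].
  suff /(_ x Px)[_] : conv_hull (range s) `<=` H by exact.
  apply: smallest_sub.
    apply: convex_set_line => y z t t0 t1 [y0 yA] [z0 zA].
    have ty0 : t * dot c y <= t * dot c (s v) by rewrite ler_pM2l.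
    have tz0 : (1 - t) * dot c z <= (1 - t) * dot c (s v).
      by rewrite ler_pM2l // subr_gt0.
    rewrite /H /= dotDr !dotZr; split=> [|E]; first by lra.
    have yE : dot c y = dot c (s v).
      by apply: (mulfI (lt0r_neq0 t0)); lra.
    have zE : dot c z = dot c (s v).
      have t1' : 1 - t != 0 by rewrite subr_eq0 eq_sym lt_eqF.
      by apply: (mulfI t1'); lra.
    rewrite (_ : _ - _ = t *: (y - s v) + (1 - t) *: (z - s v)).
      by rewrite memvD // memvZ ?yA ?zA.
    by rewrite !scalerBr addrACA -opprD -scalerDl (addrC t) subrK scale1r.
  move=> _ [i _ <-]; split; first by have := c0 i; rewrite dotBr subr_le0.
  move=> ci; apply: (mem_sumv_line (fun i => s i - s v)).
  by rewrite inE dotBr subr_eq0 ci.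
move=> _ [u uA <-].
(* W is a linear subspace: multiples are affine combinations with [s v], and a sum is twice a
   midpoint. *)
pose W := [set u | aff_hull F (s v + u)].
have aff_line x y t : aff_hull F x -> aff_hull F y ->
    aff_hull F ((1 - t) *: x + t *: y).
  by move=> Fx Fy B [aB FB]; exact: (aB _ _ _ (Fx _ (conj aB FB)) (Fy _ (conj aB FB))).
have F_aff i : dot c (s i - s v) = 0 -> aff_hull F (s i).
  move=> ci; apply: sub_gen_smallest; split.
    by apply: sub_gen_smallest; exists i.
  by move/eqP: ci; rewrite dotBr subr_eq0 => /eqP.
have Fv : aff_hull F (s v) by apply: F_aff; rewrite subrr dot0r.
have WZ a w : W w -> W (a *: w).
  move=> Ww; have := aff_line _ _ a Fv Ww; rewrite /W /=.
  by rewrite scalerDr addrA -scalerDl subrK scale1r.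
have WD w w' : W w -> W w' -> W (w + w').
  move=> Ww Ww'; have := WZ 2 _ (_ : W (2^-1 *: w + 2^-1 *: w')).
  rewrite scalerDr !scalerA mulfV ?pnatr_eq0 // !scale1r; apply.
  have := aff_line _ _ (2^-1) Ww Ww'.
  rewrite /W /= [1 - _](_ : _ = 2^-1); last by lra.
  rewrite !scalerDr addrACA -scalerDl (_ : 2^-1 + 2^-1 = 1) ?scale1r //; lra.
have W0 : W 0 by rewrite /W /= addr0.
have /memv_sumP[f fA ->] : u \in face_span s v A by [].
apply: (big_ind (fun u => W u)) => // i iA.
have /vlineP[a ->] := fA i iA; apply: WZ; rewrite /W /= addrC subrK.
by apply: F_aff; move: iA; rewrite inE => /eqP.
Qed.

End face_numbers.

(** For h on the moment curve (1, x, x^2, ...), [dot h (w i)] is a polynomial in x, nonzero if [w i]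
    is. The product of the nonzero ones has fewer roots than its size. *)
Lemma exists_generic {R : realType} {d : nat} (I : finType) (w : I -> 'rV[R]_d) :
  exists h, forall i, w i != 0 -> dot h (w i) != 0.
Proof.
pose p i : {poly R} := \sum_(j < d) w i 0 j *: 'X^j.
have p0 i : w i != 0 -> p i != 0.
  move=> /rV0Pn[j wij]; apply: contra wij => /eqP pi0.
  have := congr1 (fun q : {poly R} => q`_j) pi0; rewrite coef0 coef_sum.
  rewrite (bigD1 j) //= coefZ coefXn eqxx mulr1 big1 ?addr0 => [->//|l lj].
  by rewrite coefZ coefXn eq_sym (negPf lj : (_ == _ :> nat) = false) mulr0.
pose q := \prod_(i | w i != 0) p i.
have q0 : q != 0 by apply/prodf_neq0 => i; exact: p0.
have [x qx] : exists x, ~~ root q x.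
  pose rs : seq R := [seq n%:R | n <- iota 0 (size q)].
  have [/(max_poly_roots q0)|] := boolP (all (root q) rs).
    rewrite map_inj_uniq ?iota_uniq ?size_map ?size_iota ?ltnn => [/(_ isT)//|].
    by move=> m n /eqP; rewrite eqr_nat => /eqP.
  by rewrite -has_predC => /hasP[x _ qx]; exists x.
exists (\row_j x ^+ j) => i wi; apply: contra qx => /eqP hi.
rewrite /root horner_prod (bigD1 i) //= /p horner_sum.
rewrite [X in X * _](_ : _ = 0) ?mul0r // -[RHS]hi.
by apply: eq_bigr => j _; rewrite hornerZ hornerXn mxE mulrC.
Qed.

Lemma card_finset_le {T : finType} {U : Type} (K : {set T}) (B : set U) M
    (f : T -> U) : {in K &, injective f} -> (forall x, x \in K -> B (f x)) ->
  (B #<= `I_M)%card -> (#|K| <= M)%N.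
Proof.
move=> finj fB /pcard_leP[g].
rewrite cardE -(size_iota 0 M) -(size_map (g \o f)); apply: uniq_leq_size.
  rewrite map_inj_in_uniq ?enum_uniq // => x y.
  rewrite !mem_enum => xK yK /= gxy; apply: finj => //.
  by apply: (inj (f := g)) gxy; apply/mem_set; exact: fB.
move=> _ /mapP[x + ->]; rewrite mem_enum mem_iota add0n => /fB Bx.
exact: (funS (s := g)).
Qed.

(* V lists the vertices of P, so the second case contains f_0 <= f_k. *)
Lemma polytope_flat_or_few_vertices {R : realType} {d : nat} k M
    (P : set 'rV[R]_d) :
  (2 <= d)%N -> (k <= d./2)%N -> polytope P -> (faces k P #<= `I_M)%card ->
  (exists c b, c != 0 /\ P `<=` [set x | dot c x = b]) \/
  exists V : seq 'rV[R]_d, [/\ (size V <= M)%N, [set` V] `<=` P &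
    forall x p, P p -> exists2 v, v \in V & dot x p <= dot x v].
Proof.
move=> d2 kd [S /finite_seqP[l ->] PE] faces_le.
pose T := seq_sub l; pose s : T -> 'rV[R]_d := @ssval _ l.
have {PE} : P = conv_hull (range s).
  rewrite PE; congr (conv_hull _); apply/seteqP; split=> [x /= lx|_ [i _ <-]].
    by exists (SeqSub lx).
  exact: ssvalP.
move: faces_le => /[swap] ->.
set P' := conv_hull _ => faces_le.
have sP i : P' (s i) by apply: sub_gen_smallest; exists i.
have P'_half c b : (forall i, dot c (s i) <= b) -> P' `<=` [set x | dot c x <= b].
  move=> cb; apply: smallest_sub => [|_ [i _ <-]]; last exact: cb.
  apply: convex_set_line => x y t t0 t1 /= xb yb; rewrite dotDr !dotZr.
  have : t * dot c x <= t * b by rewrite ler_pM2l.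
  have : (1 - t) * dot c y <= (1 - t) * b by rewrite ler_pM2l // subr_gt0.
  by lra.
have flat c b : c != 0 -> (forall i, dot c (s i) = b) ->
    exists c b, c != 0 /\ P' `<=` [set x | dot c x = b].
  move=> c0 cb; exists c, b; split=> // x Px; apply/eqP; rewrite eq_le.
  rewrite (P'_half c b _ x Px) => [/=|i]; last by rewrite cb.
  rewrite -lerN2 -dotNl (P'_half (- c) (- b) _ x Px) // => i.
  by rewrite dotNl cb.
(* Without points P' is empty and lies in any hyperplane; d >= 2 provides a nonzero normal. *)
have [i0 _|T0] := pickP (@predT T); last first.
  left; apply: (flat (const_mx 1) 0) => [|i]; last by have := T0 i.
  by apply/rV0Pn; exists (Ordinal (ltnW d2)); rewrite mxE oner_eq0.
have [/eqP full|nfull] := boolP (face_span s i0 [set: T]%SET == fullv); last first.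
  have [x xU] : exists x, x \notin face_span s i0 [set: T]%SET.
    apply: contrapT => H; move/negP: nfull; apply; apply/eqP/vspaceP => x.
    by rewrite memvf; apply/negPn/negP => xU; apply: H; exists x.
  have [g [gU gx]] := exists_normal xU.
  left; apply: (flat g (dot g (s i0))) => [|i].
    by apply: contraTneq gx => ->; rewrite dot0l ltxx.
  apply/eqP; rewrite -subr_eq0 -dotBr; apply/eqP/gU.
  by apply: (mem_sumv_line (fun i => s i - s i0)); rewrite inE.
have [h hw] := exists_generic (fun p : T * T => s p.1 - s p.2).
have hinj : injective (fun i => dot h (s i)).
  move=> i j hij; have := hw (i, j); rewrite /= dotBr hij subrr eqxx.
  have sinj : injective s by exact: val_inj.
  by rewrite subr_eq0 (inj_eq sinj); have [//|_ /(_ isT)] := eqVneq i j.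
pose V := [set v | `[< exposed s v >]]%SET.
pose idx F : {set T} := [set i | `[< F (s i) >]]%SET.
pose K := [set A | `[< exists2 F, faces k P' F & idx F = A >]]%SET.
have VK : (#|V| <= #|K|)%N.
  apply: (card_exposed_le d2 kd hinj) => [v|v _|v A _ [c [c0 AE]] Ak].
  - by rewrite inE => /asboolP.
  - apply/eqP; rewrite eqEsubv subvf /= -full; apply/subv_sumP => i _; rewrite -memvE.
    rewrite (_ : _ - _ = (s i - s v) - (s i0 - s v)); last first.
      by rewrite opprB addrA subrK.
    by rewrite memvB //; apply: (mem_sumv_line (fun i => s i - s v)); rewrite inE.
  - rewrite inE; apply/asboolP.
    exists (P' `&` [set x | dot c x = dot c (s v)]); first split.
    + exists c, (dot c (s v)); split=> //; apply: P'_half => i.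
      by rewrite -subr_le0 -dotBr.
    + exists (s v), (face_span s v A); split=> //.
      by rewrite AE; exact: aff_hull_face.
    + rewrite AE; apply/setP => i; rewrite !inE dotBr subr_eq0.
      by apply/asboolP/eqP => [[]//|]; split.
have KM : (#|K| <= M)%N.
  (* f chooses a k-face for each member of K, injectively, since a face determines its index set. *)
  pose f A := xget set0 [set F | faces k P' F /\ idx F = A].
  have fP A : A \in K -> faces k P' (f A) /\ idx (f A) = A.
    rewrite inE => /asboolP[F kF FA]; rewrite /f.
    by case: xgetP => [G -> //|/(_ F)]; case.
  apply: (card_finset_le (f := f)) faces_le => [A B /fP[_ {2}<-] /fP[_ {2}<-] ->//|A].
  by case/fP.
right; exists [seq s v | v in V]; split.
- by rewrite size_map -cardE; exact: leq_trans VK KM.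
- by move=> _ /= /mapP[v _ ->].
- move=> x p Pp; have [v [ev vmax]] := exists_exposed_max x i0 hinj.
  exists (s v); last exact: P'_half Pp.
  by apply/mapP; exists v => //; rewrite mem_enum inE; apply/asboolP.
Qed.

(** * Slicing volumes *)

(** The integral is the supremum over the simple functions below, and a larger function has more of
    them. *)
Lemma ge0_le_integral_nonmeasurable {d} {T : measurableType d} {R : realType}
    (mu : {measure set T -> \bar R}) (f g : T -> \bar R) :
  (forall x, 0 <= f x)%E -> (forall x, f x <= g x)%E ->
  (\int[mu]_x f x <= \int[mu]_x g x)%E.
Proof.
move=> f0 fg; rewrite !ge0_integralTE//; last first.
  by move=> x; exact: le_trans (f0 x) (fg x).
apply: le_ereal_sup => _ [h hf <-]; exists h => // x.
exact: le_trans (hf x) (fg x).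
Qed.

(** By uniqueness of Lebesgue measure: a times its image under x -> a x + b agrees with it on
    half-open intervals. *)
Lemma lebesgue_measure_affine {R : realType} (a b : R) (Y : set (measurableTypeR R)) :
  0 < a -> measurable Y ->
  lebesgue_measure [set x : measurableTypeR R | Y (a * x + b)] =
  ((a^-1)%:E * lebesgue_measure Y)%E.
Proof.
move=> a0 mY.
pose f (x : measurableTypeR R) : measurableTypeR R := a * x + b.
have mf : measurable_fun setT f.
  by apply: measurable_funD => //; apply: measurable_funM.
pose nu := mscale (NngNum (ltW a0)) (pushforward lebesgue_measure f).
have : lebesgue_measure Y = nu mf Y.
  apply: lebesgue_measure_unique => // _ [[p q] _ <-].
  transitivity (a%:E * @lebesgue_measure R `]((p - b) / a)%R, ((q - b) / a)%R]%classic)%E;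
    last first.
    rewrite /nu /mscale /= /pushforward; congr (_ * lebesgue_measure _)%E.
    apply/seteqP; split=> x /=; rewrite !in_itv/= /f ltr_pdivrMr// ler_pdivlMr//;
      by rewrite ltrBlDr lerBrDr mulrC.
  rewrite !lebesgue_measure_itv/= !lte_fin ltr_pM2r ?invr_gt0// ltrD2r.
  case: ifPn => _; last by rewrite mule0.
  rewrite -!EFinB -EFinM; congr EFin; field; exact: lt0r_neq0.
rewrite /nu /mscale /= /pushforward => ->.
by rewrite muleA -EFinM mulVf ?mul1e// gt_eqF.
Qed.

(** * Rows as tuples, and iterated integrals for [vol] *)

Section rows.
Context {R : realType}.
Local Notation T := (measurableTypeR R).

Definition row_cons {n} (a : R) (y : 'rV[R]_n) : 'rV[R]_n.+1 :=
  \row_i oapp (fun j => y 0 j) a (unlift ord0 i).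

Lemma row_cons0 n a (y : 'rV[R]_n) : row_cons a y 0 ord0 = a.
Proof. by rewrite mxE unlift_none. Qed.

Lemma row_consS n a (y : 'rV[R]_n) j : row_cons a y 0 (lift ord0 j) = y 0 j.
Proof. by rewrite mxE liftK. Qed.

Lemma row_consE n (x : 'rV[R]_n.+1) :
  x = row_cons (x 0 ord0) (\row_j x 0 (lift ord0 j)).
Proof.
by apply/rowP => i; have [j ->|->] := unliftP ord0 i;
  rewrite ?row_consS ?row_cons0 ?mxE.
Qed.

Lemma row_cons_tuple n (a : R) (t : n.-tuple R) :
  \row_i tnth [tuple of a :: t] i = row_cons a (\row_i tnth t i).
Proof.
by apply/rowP => i; have [j ->|->] := unliftP ord0 i;
  rewrite ?row_consS ?row_cons0 !mxE ?tnthS ?tnth0.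
Qed.

Lemma dot_cons n a b (y z : 'rV[R]_n) :
  dot (row_cons a y) (row_cons b z) = a * b + dot y z.
Proof.
by rewrite /dot big_ord_recl !row_cons0; congr (_ + _);
  apply: eq_bigr => i _; rewrite !row_consS.
Qed.

Lemma row_cons_affine n (c a b : R) (y z : 'rV[R]_n) :
  c *: row_cons a y + row_cons b z = row_cons (c * a + b) (c *: y + z).
Proof.
by apply/rowP => i; have [j ->|->] := unliftP ord0 i;
  rewrite 2!mxE ?row_consS ?row_cons0 ?mxE.
Qed.

Definition row_measurable {d} (A : set 'rV[R]_d) :=
  measurable [set t : d.-tuple T | A (\row_i tnth t i)].

Definition row_mfun {d} (f : 'rV[R]_d -> R) :=
  measurable_fun setT (fun t : d.-tuple T => f (\row_i tnth t i) : T).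

Lemma row_mfun_coord d (i : 'I_d) : row_mfun (fun x => x 0 i).
Proof.
rewrite /row_mfun; under eq_fun do rewrite mxE.
exact: measurable_tnth.
Qed.

Lemma row_mfun_dotr d (c : 'rV[R]_d) : row_mfun (dot c).
Proof.
apply: measurable_sum => i; apply: measurable_funM => //.
exact: row_mfun_coord.
Qed.

Lemma row_mfun_dotxx d : row_mfun (fun x : 'rV[R]_d => dot x x).
Proof.
apply: measurable_sum => i; apply: measurable_funM; exact: row_mfun_coord.
Qed.

Lemma row_measurable_le d (f g : 'rV[R]_d -> R) : row_mfun f -> row_mfun g ->
  row_measurable [set x | f x <= g x].
Proof.
move=> mf mg; have := measurable_fun_ler mf mg measurableT (Y := [set true]).
by rewrite setTI; exact.
Qed.

Lemma row_measurable_preimage m n (f : 'rV[R]_m -> 'rV[R]_n) X :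
  (forall i, row_mfun (fun x => f x 0 i)) -> row_measurable X ->
  row_measurable (f @^-1` X).
Proof.
move=> mf mX.
pose F (t : m.-tuple T) : n.-tuple T := [tuple f (\row_j tnth t j) 0 i | i < n].
have mF : measurable_fun setT F.
  apply/measurable_fun_tnthP => i; apply: eq_measurable_fun (mf i) => t _.
  by rewrite /= tnth_mktuple.
have := mF measurableT _ mX; rewrite setTI /row_measurable.
congr measurable; apply/seteqP; split=> t /=;
  by rewrite (_ : \row_i tnth (F t) i = f (\row_j tnth t j)) //;
    apply/rowP => i; rewrite mxE tnth_mktuple.
Qed.

Lemma row_measurableI d (A B : set 'rV[R]_d) :
  row_measurable A -> row_measurable B -> row_measurable (A `&` B).
Proof. exact: measurableI. Qed.

Lemma row_measurableU d (A B : set 'rV[R]_d) :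
  row_measurable A -> row_measurable B -> row_measurable (A `|` B).
Proof. exact: measurableU. Qed.

Lemma row_measurableD d (A B : set 'rV[R]_d) :
  row_measurable A -> row_measurable B -> row_measurable (A `\` B).
Proof. exact: measurableD. Qed.

Lemma volS n (A : set 'rV[R]_n.+1) :
  vol A = (\int[@lebesgue_measure R]_a vol [set y | A (row_cons a y)])%E.
Proof.
rewrite /vol /= /pushforward /product_measure1; apply: eq_integral => a _ /=.
congr (lebesgue_tuple _ _ _); apply/seteqP; split=> t /=;
  by rewrite /xsection /= inE/= row_cons_tuple.
Qed.

Lemma row_measurable_pair n (A : set 'rV[R]_n.+1) : row_measurable A ->
  measurable [set p : T * n.-tuple T | A (\row_i tnth [tuple of p.1 :: p.2] i)].
Proof.
move=> mA.
have mc : measurable_fun setT (fun p : T * n.-tuple T => [tuple of p.1 :: p.2]).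
  exact: measurable_cons.
by have := mc measurableT _ mA; rewrite setTI.
Qed.

(** Tonelli in the other order: both iterated integrals are measures agreeing on rectangles. *)
Lemma volSr n (A : set 'rV[R]_n.+1) : row_measurable A ->
  vol A = (\int[lebesgue_tuple R n]_t
    lebesgue_measure [set a : T | A (row_cons a (\row_i tnth t i))])%E.
Proof.
move=> mA; rewrite /vol /= /pushforward.
rewrite (product_measure_unique (m' := (@lebesgue_measure R \x^ lebesgue_tuple R n)%E)).
- rewrite /product_measure2; apply: eq_integral => t _ /=.
  congr (lebesgue_measure _); apply/seteqP; split=> a /=;
    by rewrite /ysection /= inE/= row_cons_tuple.
- by move=> B C mB mC; exact: product_measure2E.
- exact: row_measurable_pair.
Qed.

Lemma measurable_vol_slice n (A : set 'rV[R]_n.+1) : row_measurable A ->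
  measurable_fun setT (fun a : T => vol [set y | A (row_cons a y)]).
Proof.
move=> /row_measurable_pair /(measurable_fun_xsection (lebesgue_tuple R n)).
apply: eq_measurable_fun => a _ /=; rewrite /vol; congr (lebesgue_tuple _ _ _).
by apply/seteqP; split=> t /=; rewrite /xsection /= inE/= row_cons_tuple.
Qed.

Lemma measurable_lebesgue_slice n (A : set 'rV[R]_n.+1) : row_measurable A ->
  measurable_fun setT (fun t : n.-tuple T =>
    lebesgue_measure [set a : T | A (row_cons a (\row_i tnth t i))]).
Proof.
move=> /row_measurable_pair /(measurable_fun_ysection (@lebesgue_measure R)).
apply: eq_measurable_fun => t _ /=; congr (lebesgue_measure _).
by apply/seteqP; split=> a /=; rewrite /ysection /= inE/= row_cons_tuple.
Qed.

Lemma row_measurable_slice n (A : set 'rV[R]_n.+1) a : row_measurable A ->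
  row_measurable [set y | A (row_cons a y)].
Proof.
apply: row_measurable_preimage => i; have [j ->|->] := unliftP ord0 i.
- by under eq_fun do rewrite row_consS; exact: row_mfun_coord.
- by under eq_fun do rewrite row_cons0; exact: measurable_cst.
Qed.

Lemma measurable_line n (A : set 'rV[R]_n.+1) (t : n.-tuple R) :
  row_measurable A ->
  measurable [set a : T | A (row_cons a (\row_i tnth t i))].
Proof.
move=> /row_measurable_pair /(measurable_ysection t).
congr measurable.
by apply/seteqP; split=> a /=; rewrite /ysection /= inE/= row_cons_tuple.
Qed.

(** Induction through [volS] reaches arbitrary sets, so the ball minus P can be compared with
    measurable sets. *)
Lemma le_vol d (A B : set 'rV[R]_d) : A `<=` B -> (vol A <= vol B)%E.
Proof.
elim: d A B => [|n IHn] A B AB.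
  rewrite /vol /= !diracE lee_fin ler_nat.
  set t := [tuple]; have [Bt|Bt] := pselect (B (\row_i tnth t i)).
    by rewrite (@mem_set _ [set t | B _] t Bt) leq_b1.
  by rewrite (@memNset _ [set t | A _] t) // => /AB.
rewrite !volS; apply: ge0_le_integral_nonmeasurable => a.
  exact: measure_ge0.
by apply: IHn => y /AB.
Qed.

End rows.

(** * Behaviour under affine maps *)

Section volume.
Context {R : realType}.
Local Notation T := (measurableTypeR R).

Lemma vol_ge0 d (A : set 'rV[R]_d) : (0 <= vol A)%E.
Proof. exact: measure_ge0. Qed.

Lemma vol_set0 d : vol (@set0 'rV[R]_d) = 0%E.
Proof. exact: (measure0 (lebesgue_tuple R d)). Qed.

Lemma volU d (A B : set 'rV[R]_d) : row_measurable A -> row_measurable B ->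
  (vol (A `|` B) <= vol A + vol B)%E.
Proof. by move=> mA mB; exact: (measureU2 (lebesgue_tuple R d)). Qed.

Lemma row_mfun_affine d (c : R) (b : 'rV[R]_d) i :
  row_mfun (fun x => (c *: x + b) 0 i).
Proof.
rewrite /row_mfun; under eq_fun do rewrite 2!mxE.
apply: measurable_funD => //; apply: measurable_funM => //.
exact: row_mfun_coord.
Qed.

Definition row_tail {n} (x : 'rV[R]_n.+1) : 'rV[R]_n := \row_j x 0 (lift ord0 j).

Lemma row_tail_cons n a (y : 'rV[R]_n) : row_tail (row_cons a y) = y.
Proof. by apply/rowP => j; rewrite mxE row_consS. Qed.

Lemma row_mfun_tail n (f : 'rV[R]_n -> R) : row_mfun f ->
  row_mfun (fun x : 'rV[R]_n.+1 => f (row_tail x)).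
Proof.
move=> mf; rewrite /row_mfun.
have mb : measurable_fun setT (fun t : n.+1.-tuple T => [tuple of behead t] : n.-tuple T).
  exact: measurable_behead.
apply: eq_measurable_fun (measurableT_comp mf mb) => t _ /=; congr f.
by apply/rowP => j; rewrite !mxE (tuple_eta t) tnthS -tuple_eta.
Qed.

Lemma row_measurable_map_cons n (g : 'rV[R]_n.+1 -> R)
    (h : 'rV[R]_n.+1 -> 'rV[R]_n) X : row_mfun g ->
  (forall j, row_mfun (fun x => h x 0 j)) -> row_measurable X ->
  row_measurable [set x : 'rV[R]_n.+1 | X (row_cons (g x) (h x))].
Proof.
move=> mg mh; apply: row_measurable_preimage => i.
have [j ->|->] := unliftP ord0 i.
- by under eq_fun do rewrite row_consS; exact: mh.
- by under eq_fun do rewrite row_cons0; exact: mg.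
Qed.

(** On each line parallel to the first axis the map is affine of slope c. For c = 1 and f linear it
    is a shear. *)
Lemma vol_stretch n (c : R) (f : 'rV[R]_n -> R) (X : set 'rV[R]_n.+1) :
  0 < c -> row_mfun f -> row_measurable X ->
  vol [set x : 'rV[R]_n.+1 | X (row_cons (c * x 0 ord0 + f (row_tail x)) (row_tail x))] =
  ((c^-1)%:E * vol X)%E.
Proof.
move=> c0 mf mX; rewrite !volSr //; last first.
  apply: row_measurable_map_cons => //.
    apply: measurable_funD; last exact: row_mfun_tail.
    by apply: measurable_funM => //; exact: row_mfun_coord.
  by move=> j; under eq_fun do rewrite mxE; exact: row_mfun_coord.
rewrite -ge0_integralZl //; last 2 first.
- exact: measurable_lebesgue_slice.
- by rewrite lee_fin invr_ge0 ltW.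
apply: eq_integral => t _ /=.
under eq_set do rewrite row_cons0 row_tail_cons.
exact: (lebesgue_measure_affine _ c0 (measurable_line t mX)).
Qed.

Lemma vol_affine d (c : R) (b : 'rV[R]_d) X : 0 < c -> row_measurable X ->
  vol [set x | X (c *: x + b)] = ((c^-1 ^+ d)%:E * vol X)%E.
Proof.
move=> c0; elim: d b X => [|n IHn] b X mX.
  rewrite expr0 mul1e; congr (vol _); apply/seteqP.
  by split=> x /=; rewrite (thinmx0 (_ + _)) (thinmx0 x).
pose X' := [set x : 'rV[R]_n.+1 | X (row_cons (c * x 0 ord0 + b 0 ord0) (row_tail x))].
have mX' : row_measurable X'.
  apply: row_measurable_map_cons => //.
    apply: measurable_funD => //.
    by apply: measurable_funM => //; exact: row_mfun_coord.
  by move=> j; under eq_fun do rewrite mxE; exact: row_mfun_coord.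
transitivity ((c^-1 ^+ n)%:E * vol X')%E; last first.
  rewrite /X' (vol_stretch (f := fun=> b 0 ord0) c0) //.
    by rewrite muleA -EFinM exprSr.
  exact: measurable_cst.
rewrite !volS -ge0_integralZl //; last 2 first.
- exact: (measurable_vol_slice mX').
- by rewrite lee_fin exprn_ge0 // invr_ge0 ltW.
apply: eq_integral => a _; rewrite -(IHn (row_tail b)); last first.
  exact: row_measurable_slice.
have E y : c *: row_cons a y + b = row_cons (c * a + b 0 ord0) (c *: y + row_tail b).
  by rewrite {1}(row_consE b) row_cons_affine.
by congr (vol _); apply/seteqP; split=> y /=; rewrite /X' /= E row_cons0 row_tail_cons.
Qed.

(** If the tail of the normal is nonzero, every slice is a hyperplane one dimension lower. Otherwise
    only the slice at b / c0 is nonempty. *)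
Lemma vol_hyperplane d (c : 'rV[R]_d) (b : R) : c != 0 ->
  vol [set x | dot c x = b] = 0%E.
Proof.
elim: d c b => [c b|n IHn c b]; first by rewrite thinmx0 eqxx.
rewrite (row_consE c) -/(row_tail c); set c0 := c 0 ord0; set c' := row_tail c.
have [-> cn0|c'0 _] := eqVneq c' 0; last first.
  rewrite volS integral0_eq // => a _; rewrite -[RHS](IHn c' (b - c0 * a) c'0).
  congr (vol _); apply/seteqP; split=> y /=; rewrite dot_cons => H;
    by [rewrite -H addrC addKr|rewrite H addrC subrK].
have c00 : c0 != 0.
  apply: contra cn0 => /eqP ->; apply/eqP/rowP => i.
  by have [j ->|->] := unliftP ord0 i; rewrite ?row_consS ?row_cons0 !mxE.
apply/eqP; rewrite eq_le vol_ge0 andbT.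
rewrite volS -[leRHS](integral_set1 (cst +oo%E) (b / c0)) [leRHS]integral_mkcond.
apply: ge0_le_integral_nonmeasurable => a; first exact: vol_ge0.
rewrite patchE; case: ifPn => [_|ab]; first exact: leey.
rewrite (_ : [set y | _] = set0) ?vol_set0 //; apply/seteqP; split=> // y /=.
rewrite dot_cons dot0l addr0 => H; move/negP: ab; apply.
by rewrite inE /= -H mulrC mulKf.
Qed.

Lemma vol_shear n (w : 'rV[R]_n) (X : set 'rV[R]_n.+1) : row_measurable X ->
  vol [set x : 'rV[R]_n.+1 | X (row_cons (x 0 ord0) (row_tail x + x 0 ord0 *: w))] = vol X.
Proof.
move=> mX; rewrite !volS; apply: eq_integral => a _ /=.
under eq_set do rewrite row_cons0 row_tail_cons -[X in X + _]scale1r.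
have mXa : row_measurable [set y | X (row_cons a y)] by exact: row_measurable_slice.
by rewrite (vol_affine (a *: w) ltr01 mXa) invr1 expr1n mul1e.
Qed.

End volume.

(** * Rotations and balls *)

Section rotation.
Context {R : realType}.

(* A rotation by a nonzero angle in the plane of e_0 and w is a product of
   three shears. *)
Lemma vol_first_coord_dot_neq0 n (v0 : R) (v' : 'rV[R]_n) (Y : R -> R -> Prop) :
  v' != 0 -> v0 ^+ 2 + dot v' v' = 1 ->
  row_measurable [set x : 'rV[R]_n.+1 | Y (x 0 ord0) (dot x x)] ->
  vol [set x | Y (dot (row_cons v0 v') x) (dot x x)] =
  vol [set x : 'rV[R]_n.+1 | Y (x 0 ord0) (dot x x)].
Proof.
move=> v'0 v1 mY.
pose s := Num.sqrt (dot v' v').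
have s2 : s ^+ 2 = dot v' v' by rewrite sqr_sqrtr // dot_ge0.
have s0 : s != 0 by rewrite sqrtr_eq0 -ltNge lt_neqAle dot_ge0 eq_sym dot_eq0 v'0.
(* v0 and s are the cosine and sine of the angle; [al], minus the tangent of half of it, is the
   factor of the outer shears S1, and s that of the middle shear S2. *)
pose w := - s^-1 *: v'; pose al := (v0 - 1) / s.
have als : al * s = v0 - 1 by rewrite mulfVK.
have alv : al * (v0 + 1) = - s.
  apply: (mulIf s0); rewrite mulrAC als mulNr -expr2 s2.
  by rewrite -[dot v' v'](addKr (v0 ^+ 2)) v1; ring.
have ww : dot w w = 1.
  by rewrite dotZl dotZr -s2 expr2; field.
have v'w y : dot v' y = - s * dot w y by rewrite dotZl; field.
clearbody w.
pose S1 (x : 'rV[R]_n.+1) :=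
  row_cons (1 * x 0 ord0 + dot (al *: w) (row_tail x)) (row_tail x).
pose S2 (x : 'rV[R]_n.+1) :=
  row_cons (x 0 ord0) (row_tail x + x 0 ord0 *: (s *: w)).
have mtail i : row_mfun (fun x : 'rV[R]_n.+1 => row_tail x 0 i).
  by under eq_fun do rewrite mxE; exact: row_mfun_coord.
have mS1 Z : row_measurable Z -> row_measurable [set x | Z (S1 x)].
  apply: row_measurable_map_cons => //.
  apply: measurable_funD; last exact: (row_mfun_tail (row_mfun_dotr _)).
  by apply: measurable_funM => //; exact: row_mfun_coord.
have mS2 Z : row_measurable Z -> row_measurable [set x | Z (S2 x)].
  apply: row_measurable_map_cons => [|j]; first exact: row_mfun_coord.
  rewrite /row_mfun; under eq_fun do rewrite mxE [X in _ + X]mxE.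
  apply: measurable_funD; first exact: mtail.
  by apply: measurable_funM => //; exact: row_mfun_coord.
have vS1 Z : row_measurable Z -> vol [set x | Z (S1 x)] = vol Z.
  move=> mZ; rewrite (vol_stretch ltr01 (row_mfun_dotr _) mZ).
  by rewrite invr1 mul1e.
have vS2 Z : row_measurable Z -> vol [set x | Z (S2 x)] = vol Z.
  by move=> mZ; exact: vol_shear.
rewrite -(vS1 _ mY) -(vS2 _ (mS1 _ mY)) -(vS1 _ (mS2 _ (mS1 _ mY))).
congr (vol _); apply/funext => x /=.
(* With a the first coordinate and p the one along w, the composite sends (a, p) to (v0 a - s p, s a
   + v0 p). *)
suff [-> ->] : S1 (S2 (S1 x)) 0 ord0 = dot (row_cons v0 v') x /\
  dot (S1 (S2 (S1 x))) (S1 (S2 (S1 x))) = dot x x by [].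
rewrite (row_consE x) -/(row_tail x).
set a := x 0 ord0; set y := row_tail x; pose p := dot w y.
rewrite /S1 /S2 !(row_cons0, row_tail_cons) !dot_cons.
rewrite !(dotDl, dotDr, dotZl, dotZr) ww (dotC y w) v'w -/p.
set q := _ + al * p; set b := _ + (_ + al * _).
have qE : q * s = s * a + (v0 - 1) * p by rewrite -als /q; ring.
have bE : b = v0 * a - s * p.
  have -> : b = a + (al * s) * a + (2 * al + (al * s) * al) * p by rewrite /b /q; ring.
  rewrite als; have -> : - (s * p) = al * (v0 + 1) * p by rewrite alv; ring.
  by ring.
split; first by rewrite bE; ring.
have K : (s ^+ 2 + v0 ^+ 2 - 1) * (a ^+ 2 + p ^+ 2) = 0.
  by rewrite s2 (addrC (dot v' v')) v1 subrr mul0r.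
rewrite [LHS](_ : _ = b ^+ 2 + dot y y + 2 * (q * s) * p + (q * s) ^+ 2);
  last by ring.
by rewrite qE bE; lra.
Qed.

(** Beyond the previous lemma there remain v = e_0, which is trivial, and v = -e_0, reached by two
    rotations through a unit vector u orthogonal to e_0; it exists as n > 0. *)
Lemma vol_first_coord_dot n (v : 'rV[R]_n.+1) (Y : R -> R -> Prop) :
  (0 < n)%N -> dot v v = 1 ->
  row_measurable [set x : 'rV[R]_n.+1 | Y (x 0 ord0) (dot x x)] ->
  vol [set x | Y (dot v x) (dot x x)] =
  vol [set x : 'rV[R]_n.+1 | Y (x 0 ord0) (dot x x)].
Proof.
move=> n0; rewrite (row_consE v) -/(row_tail v) dot_cons.
move: (v 0 ord0) (row_tail v) => v0 v' v1 mY.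
have [v'0|v'0] := eqVneq v' 0; last first.
  by rewrite vol_first_coord_dot_neq0 // expr2.
move: v1; rewrite v'0 dot0l addr0 -expr2 => /eqP; rewrite sqrf_eq1.
have E : [set x | Y (dot (row_cons v0 0) x) (dot x x)] =
    [set x : 'rV[R]_n.+1 | Y (v0 * x 0 ord0) (dot x x)].
  apply/funext => x /=; congr Y.
  by rewrite {1}(row_consE x) dot_cons dot0l addr0.
rewrite {}E => /orP[/eqP->|/eqP->].
  by congr (vol _); apply/funext => x /=; rewrite mul1r.
pose u : 'rV[R]_n := delta_mx 0 (Ordinal n0).
have u0 : u != 0 by apply/rV0Pn; exists (Ordinal n0); rewrite mxE !eqxx oner_eq0.
have u1 : 0 ^+ 2 + dot u u = 1.
  rewrite expr0n add0r /dot (bigD1 (Ordinal n0)) //= big1 => [|i /negPf i0].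
    by rewrite !mxE !eqxx mulr1 addr0.
  by rewrite !mxE i0 andbF mulr0.
have u1N : 0 ^+ 2 + dot (- u) (- u) = 1 by rewrite dotNl dotNr opprK.
rewrite -(vol_first_coord_dot_neq0 _ u1N mY) ?oppr_eq0 //.
under [in LHS]eq_set do rewrite mulN1r.
rewrite -(vol_first_coord_dot_neq0 (Y := fun p q => Y (- p) q) u0 u1).
  congr (vol _); apply/funext => x /=; congr Y.
  by rewrite (row_consE x) !dot_cons !mul0r !add0r dotNl.
rewrite (_ : mkset _ = [set x : 'rV[R]_n.+1 | [set x : 'rV[R]_n.+1 |
  Y (x 0 ord0) (dot x x)] (row_cons (- x 0 ord0) (row_tail x))]).
  apply: row_measurable_map_cons => // [|j].
    by apply: measurable_funN; exact: row_mfun_coord.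
  by under eq_fun do rewrite mxE; exact: row_mfun_coord.
apply/funext => x /=; rewrite row_cons0; congr Y.
by rewrite {1 2}(row_consE x) !dot_cons mulrNN.
Qed.

End rotation.

Section ball.
Context {R : realType}.

Lemma unit_ballE d : @unit_ball R d = [set x | dot x x <= 1].
Proof.
apply/funext => x; rewrite /unit_ball /enorm /=.
by rewrite -{1}sqrtr1 ler_sqrt.
Qed.

Lemma row_measurable_ball d (q : R) : row_measurable [set x : 'rV[R]_d | dot x x <= q].
Proof.
apply: (row_measurable_le (g := fun=> q)); first exact: row_mfun_dotxx.
exact: measurable_cst.
Qed.

Lemma row_measurable_unit_ball d : row_measurable (@unit_ball R d).
Proof. by rewrite unit_ballE; exact: row_measurable_ball. Qed.

(** The ball lies in the cube [-1, 1]^d, so its volume is finite and [fine] loses nothing. *)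
Lemma kappaE d : (kappa R d)%:E = vol (@unit_ball R d).
Proof.
rewrite /kappa fineK // ge0_fin_numE ?vol_ge0 //.
apply: (@le_lt_trans _ _ (vol [set x : 'rV[R]_d | forall i, `[-1, 1]%classic (x 0 i)])).
  apply: le_vol => x; rewrite unit_ballE /= => x1 i.
  have : x 0 i ^+ 2 <= 1.
    apply: le_trans x1; rewrite /dot (bigD1 i) //= -expr2 lerDl sumr_ge0 // => j _.
    by rewrite -expr2 sqr_ge0.
  by rewrite -(real_normK (num_real _)) expr_le1 // ler_norml in_itv.
rewrite (_ : vol _ = lebesgue_tuple R d
    [set t | forall i, (fun=> `[-1, 1]%classic) i (tnth t i)]); last first.
  congr (lebesgue_tuple _ _ _); apply/seteqP.
  by split=> t /= H i; have := H i; rewrite mxE.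
rewrite (@lebesgue_tuple_box R d (fun=> `[-1, 1]%classic)) => [|i]; last exact: measurable_itv.
rewrite -ge0_fin_numE; last by apply: prode_ge0 => i _; exact: measure_ge0.
apply: (big_ind (fun x => x \is a fin_num)) => // [x y|i _]; first exact: fin_numM.
by rewrite lebesgue_measure_itv /=; case: ifP.
Qed.

Lemma kappa_ge0 d : 0 <= kappa R d.
Proof. by rewrite -lee_fin kappaE vol_ge0. Qed.

Lemma vol_ball_le n (rho : R) : (0 < n)%N -> 0 <= rho ->
  (vol [set y : 'rV[R]_n | dot y y <= rho ^+ 2]%R <= (rho ^+ n * kappa R n)%:E)%E.
Proof.
move=> n0; rewrite le_eqVlt => /predU1P[<-|rho0].
  (* For rho = 0 the ball is the origin alone, which lies on a hyperplane as n > 0. *)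
  rewrite (expr0n _ n) gtn_eqF // mul0r.
  have e0 : (const_mx 1 : 'rV[R]_n) != 0.
    by apply/rV0Pn; exists (Ordinal n0); rewrite mxE oner_eq0.
  rewrite -[leRHS](vol_hyperplane 0 e0); apply: le_vol => y /=.
  rewrite expr0n /= => y0; have /eqP : dot y y = 0.
    by apply/eqP; rewrite eq_le y0 dot_ge0.
  by rewrite dot_eq0 => /eqP ->; rewrite dot0r.
have -> : [set y : 'rV[R]_n | dot y y <= rho ^+ 2] =
    [set y | unit_ball n (rho^-1 *: y + 0)].
  apply/funext => y; rewrite unit_ballE /= addr0 dotZl dotZr mulrA -expr2.
  by rewrite exprVn ler_pdivrMl ?mulr1 // exprn_gt0.
rewrite vol_affine ?invr_gt0 ?invrK -?kappaE //.
exact: row_measurable_unit_ball.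
Qed.

End ball.

(** * Sectors *)

Lemma integral_monomial {R : realType} (k r : R) n : 0 < r ->
  (\int[lebesgue_measure]_(x in `[0%R, r]) (k * x ^+ n)%:E =
   (k * r ^+ n.+1 / n.+1%:R)%:E)%E.
Proof.
move=> r0; pose F (x : R) := k / n.+1%:R * x ^+ n.+1.
have cX m : continuous (fun x : R => x ^+ m) by exact: exprn_continuous.
have dX (x : R) : derivable (fun x : R => x ^+ n.+1) x 1 by exact: exprn_derivable.
have dF (x : R) : derivable F x 1 by apply: derivableM => //; exact: derivable_cst.
have cM m c : continuous (fun x : R => c * x ^+ m).
  by move=> x; apply: cvgM; [exact: cvg_cst|exact: cX].
rewrite (@continuous_FTC2 _ _ F) //.
- by rewrite /F expr0n /= mulr0 sube0; congr EFin; rewrite mulrAC mulrC.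
- by apply: continuous_in_subspaceT => x _; exact: cM.
- split=> [x _||]; first exact: dF.
  + by apply: cvg_at_right_filter; exact: cM.
  + by apply: cvg_at_left_filter; exact: cM.
- move=> x _; rewrite derive1E (deriveMl _ (dX x)) exp_derive /=.
  by rewrite /GRing.scale /= mulr1 mulrA divfK // pnatr_eq0.
Qed.

Section sector.
Context {R : realType}.

(* The points x of the unit ball with [r * |x| <= dot v x], for 0 <= r. *)
Definition sector {d} (r : R) (v : 'rV[R]_d) : set 'rV[R]_d :=
  [set x | dot x x <= 1 /\ 0 <= dot v x /\ r ^+ 2 * dot x x <= dot v x ^+ 2].

Lemma row_measurable_sector d r (v : 'rV[R]_d) : row_measurable (sector r v).
Proof.
apply: row_measurableI; first exact: row_measurable_ball.
apply: row_measurableI; apply: row_measurable_le.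
- exact: measurable_cst.
- exact: row_mfun_dotr.
- by apply: measurable_funM => //; exact: row_mfun_dotxx.
- by apply: measurable_funX; exact: row_mfun_dotr.
Qed.

(* The part of the sector below height r lies in a cone over a ball of radius
   [sqrt (1 - r ^+ 2)], the part above in a cylinder over it. *)
Lemma vol_sector_slice n (r a k : R) : (0 < n)%N -> 0 < r -> r <= 1 ->
  k = kappa R n * Num.sqrt (1 - r ^+ 2) ^+ n ->
  (vol [set y : 'rV[R]_n | a * a + dot y y <= 1 /\ 0 <= a /\
      r ^+ 2 * (a * a + dot y y) <= a ^+ 2]%R <=
   ((fun x => (k / r ^+ n * x ^+ n)%:E) \_ `[0%R, r]) a +
   ((cst k%:E) \_ `[r, 1%R]) a)%E.
Proof.
set s := Num.sqrt _ => n0 r0 r1 kE; set X := [set y | _].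
have k0 : 0 <= k by rewrite kE mulr_ge0 ?kappa_ge0 ?exprn_ge0 ?sqrtr_ge0.
have f1_ge0 : (0 <= ((fun x => (k / r ^+ n * x ^+ n)%:E) \_ `[0%R, r]) a)%E.
  apply: erestrict_ge0 => x; rewrite /= in_itv /= => /andP[x0 _].
  by rewrite lee_fin mulr_ge0 ?divr_ge0 ?exprn_ge0 // ltW.
have f2_ge0 : (0 <= ((cst k%:E) \_ `[r, 1%R]) a)%E.
  by apply: erestrict_ge0 => x _; rewrite lee_fin.
have [a0|a0] := ltP a 0.
  rewrite (_ : X = set0) ?vol_set0 ?adde_ge0 //.
  by apply/seteqP; split=> // y [_ []]; rewrite leNgt a0.
have [a1|a1] := ltP 1 a.
  rewrite (_ : X = set0) ?vol_set0 ?adde_ge0 //.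
  by apply/seteqP; split=> // y [ay _]; have := dot_ge0 y; nra.
have [ar|ar] := leP a r.
  rewrite -[leLHS]adde0; apply: leeD => //.
  rewrite patchE mem_set /= ?in_itv /= ?a0 //.
  (* r^2 (a^2 + |y|^2) <= a^2 means |y| <= (a / r) s. *)
  have -> : k / r ^+ n * a ^+ n = (a / r * s) ^+ n * kappa R n.
    by rewrite kE !exprMn exprVn; ring.
  apply: le_trans (vol_ball_le n0 _); last first.
    by rewrite mulr_ge0 ?sqrtr_ge0 // divr_ge0 // ltW.
  apply: le_vol => y [_ [_ yr]] /=.
  have s1 : 0 <= 1 - r ^+ 2 by rewrite subr_ge0 exprn_ile1 // ltW.
  rewrite exprMn sqr_sqrtr // exprMn exprVn mulrAC ler_pdivlMr ?exprn_gt0 //.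
  by move: yr; set q := dot y y; set p := r ^+ 2; lra.
rewrite -[leLHS]add0e; apply: leeD => //.
rewrite patchE mem_set /= ?in_itv /= ?(ltW ar) //.
rewrite kE mulrC; apply: le_trans (vol_ball_le n0 (sqrtr_ge0 _)).
apply: le_vol => y [ya _] /=; rewrite sqr_sqrtr; last by nra.
by have : r * r <= a * a; nra.
Qed.

(** With d = n + 1, the slices integrate to at most k r / d for the cone plus k (1 - r) for the
    cylinder, and r + d (1 - r) <= 2. *)
Lemma vol_sector n (r : R) (v : 'rV[R]_n.+1) : (0 < n)%N -> 0 < r -> r <= 1 ->
  n.+1%:R * (1 - r) <= 1 -> dot v v <= 1 ->
  (vol (sector r v) <=
   (kappa R n * Num.sqrt (1 - r ^+ 2) ^+ n * (2 / n.+1%:R))%:E)%E.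
Proof.
move=> n0 r0 r1 nr v1; set k := kappa R n * _.
have k0 : 0 <= k by rewrite mulr_ge0 ?kappa_ge0 ?exprn_ge0 ?sqrtr_ge0.
pose Y (p q : R) := q <= 1 /\ 0 <= p /\ r ^+ 2 * q <= p ^+ 2.
pose e : 'rV[R]_n.+1 := row_cons 1 0.
have e1 : dot e e = 1 by rewrite dot_cons dot0l addr0 mulr1.
have e_first (x : 'rV[R]_n.+1) : dot e x = x 0 ord0.
  by rewrite {1}(row_consE x) dot_cons dot0l addr0 mul1r.
have mY : row_measurable [set x : 'rV[R]_n.+1 | Y (x 0 ord0) (dot x x)].
  by under eq_set do rewrite -e_first; exact: (row_measurable_sector r e).
(* Normalizing v enlarges the sector, as |v| <= 1; for v = 0 the sector is the origin alone. *)
have [u u1 vu] : exists2 u, dot u u = 1 & sector r v `<=` sector r u.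
  have [->|v0] := eqVneq v 0.
    exists e => // x [x1 [_]]; rewrite dot0l expr0n /=.
    rewrite pmulr_rle0 ?exprn_gt0 // => x0; have : dot x x == 0.
      by rewrite eq_le x0 dot_ge0.
    by rewrite dot_eq0 => /eqP ->; rewrite /sector /= !dot0r expr0n mulr0.
  have vv0 : 0 < dot v v by rewrite lt_neqAle dot_ge0 eq_sym dot_eq0 v0.
  pose c := Num.sqrt (dot v v); have c0 : 0 < c by rewrite sqrtr_gt0.
  have c2 : c ^+ 2 = dot v v by rewrite sqr_sqrtr // ltW.
  have c1 : 1 <= c^-1 by rewrite invf_ge1 // -(@ler_pXn2r _ 2) ?nnegrE ?(ltW c0) // c2 expr1n.
  exists (c^-1 *: v); first by rewrite dotZl dotZr -c2 expr2 mulKf ?mulVf ?gt_eqF.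
  move=> x [x1 [vx0 vxr]]; split=> //; rewrite dotZl; split.
    by rewrite mulr_ge0 // invr_ge0 ltW.
  apply: le_trans vxr _; rewrite exprMn ler_peMl ?sqr_ge0 //.
  by rewrite exprn_ege1.
apply: le_trans (le_vol vu) _.
rewrite (_ : sector r u = [set x | Y (dot u x) (dot x x)]) //.
rewrite (vol_first_coord_dot n0 u1 mY) volS.
apply: (@le_trans _ _ (\int[lebesgue_measure]_a
   (((fun x => (k / r ^+ n * x ^+ n)%:E) \_ `[0%R, r]) a +
    ((cst k%:E) \_ `[r, 1%R]) a))%E).
  apply: ge0_le_integral_nonmeasurable => a; first exact: vol_ge0.
  rewrite /Y /=; under eq_set do rewrite row_cons0 dot_cons.
  exact: vol_sector_slice n0 r0 r1 (erefl _).
rewrite ge0_integralD //; first last.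
- by apply/(measurable_restrictT _ _).1.
- by move=> x _; apply: erestrict_ge0 => y _; rewrite lee_fin.
- apply/(measurable_restrictT _ _).1 => //; apply/measurable_EFinP.
  by apply: measurable_funM => //; exact: measurable_funX.
- move=> x _; apply: erestrict_ge0 => y; rewrite /= in_itv /= => /andP[y0 _].
  by rewrite lee_fin mulr_ge0 ?divr_ge0 ?exprn_ge0 // ltW.
rewrite -!integral_mkcond integral_monomial // integral_cst //=.
rewrite lebesgue_measure_itv /= lte_fin.
have -> : (if (r < 1)%R then 1%:E - r%:E else 0)%E = (1 - r)%:E.
  by case: ltP => // r1'; rewrite (_ : r = 1) ?subrr //; apply/eqP; rewrite eq_le r1.
rewrite -EFinM -EFinD lee_fin.
have -> : k / r ^+ n * r ^+ n.+1 / n.+1%:R = k * (r / n.+1%:R).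
  have : r ^+ n != 0 by rewrite expf_neq0 ?gt_eqF.
  rewrite exprS; move: (r ^+ n) => q q0; field.
  by rewrite q0 nat1r pnatr_eq0.
rewrite -mulrDr ler_wpM2l // -(ler_pM2r (ltr0Sn R n)) mulrDl !divfK ?pnatr_eq0 //.
by lra.
Qed.

End sector.

(** * Missing volume *)

Section missing_volume.
Context {R : realType}.

Definition sectors {d} (r : R) (V : seq 'rV[R]_d) : set 'rV[R]_d :=
  [set x | exists2 v, v \in V & sector r v x].

Lemma sectors_cons d (r : R) v (V : seq 'rV[R]_d) :
  sectors r (v :: V) = sector r v `|` sectors r V.
Proof.
apply/seteqP; split=> x.
  by move=> [w]; rewrite inE => /predU1P[->|wV]; [left|right; exists w].
move=> [xv|[w wV xw]]; first by exists v; rewrite // mem_head.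
by exists w; rewrite // inE wV orbT.
Qed.

Lemma sectors_nil d (r : R) : sectors r (nil : seq 'rV[R]_d) = set0.
Proof. by apply/seteqP; split=> // x [w]. Qed.

Lemma row_measurable_sectors d (r : R) (V : seq 'rV[R]_d) :
  row_measurable (sectors r V).
Proof.
elim: V => [|v V IHV]; first by rewrite sectors_nil; exact: measurable0.
by rewrite sectors_cons; apply: row_measurableU => //; exact: row_measurable_sector.
Qed.

Lemma vol_sectors d (r c : R) (V : seq 'rV[R]_d) :
  (forall v, v \in V -> (vol (sector r v) <= c%:E)%E) ->
  (vol (sectors r V) <= ((size V)%:R * c)%:E)%E.
Proof.
elim: V => [|v V IHV] Vc; first by rewrite sectors_nil vol_set0 mul0r.
rewrite sectors_cons; apply: le_trans (volU _ _) _.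
- exact: row_measurable_sector.
- exact: row_measurable_sectors.
rewrite /= -[(size V).+1%:R]nat1r mulrDl mul1r EFinD; apply: leeD.
  by apply: Vc; rewrite mem_head.
by apply: IHV => w wV; apply: Vc; rewrite inE wV orbT.
Qed.

(* With D the unit ball minus the sectors, the points of D of norm > r miss P,
   and the points of D of norm <= r form the dilate r D. *)
Lemma vol_ball_setD_ge n (r : R) (V : seq 'rV[R]_n.+1) (P : set 'rV[R]_n.+1) :
  (0 < n)%N -> 0 < r -> r <= 1 -> n.+1%:R * (1 - r) <= 1 ->
  (forall v, v \in V -> dot v v <= 1) ->
  (forall p, P p -> exists2 v, v \in V & dot p p <= dot p v) ->
  (size V)%:R * (kappa R n * Num.sqrt (1 - r ^+ 2) ^+ n * (2 / n.+1%:R)) <=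
    kappa R n.+1 / 2 ->
  (((1 - r ^+ n.+1) * (kappa R n.+1 / 2))%:E <= vol (unit_ball n.+1 `\` P))%E.
Proof.
move=> n0 r0 r1 nr V1 PV Vk.
pose A := sectors r V; have mA : row_measurable A by exact: row_measurable_sectors.
have mB := @row_measurable_unit_ball R n.+1.
pose D := unit_ball n.+1 `\` A; have mD : row_measurable D by exact: row_measurableD.
pose Dr := [set x | D (r^-1 *: x + 0)].
have mDr : row_measurable Dr.
  by apply: row_measurable_preimage => // i; exact: row_mfun_affine.
have vA : (vol A <= (kappa R n.+1 / 2)%:E)%E.
  by apply: le_trans (vol_sectors (fun v vV => vol_sector n0 r0 r1 nr (V1 v vV))) _.
have vB : ((kappa R n.+1)%:E <= vol D + vol A)%E.
  rewrite kappaE; apply: le_trans (volU mD mA); apply: le_vol => x Bx.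
  by have [Ax|Ax] := pselect (A x); [right|left].
have vDr : vol Dr = ((r ^+ n.+1)%:E * vol D)%E.
  by rewrite /Dr vol_affine ?invr_gt0 // invrK.
have Dfin : vol D \is a fin_num.
  rewrite ge0_fin_numE ?vol_ge0 //.
  apply: (@le_lt_trans _ _ (vol (@unit_ball R n.+1))); last by rewrite -kappaE ltry.
  by apply: le_vol => x [].
have vD : (vol D <= vol (D `\` Dr) + vol Dr)%E.
  apply: le_trans (volU (row_measurableD mD mDr) mDr); apply: le_vol => x Dx.
  by have [?|?] := pselect (Dr x); [right|left].
have DP : D `\` Dr `<=` unit_ball n.+1 `\` P.
  move=> x [[Bx Ax] Drx]; split=> // Px; have [v vV xv] := PV x Px.
  have x1 : dot x x <= 1 by move: Bx; rewrite unit_ballE.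
  have x0 := dot_ge0 x.
  (* If |x| <= r, then x / r is in the unit ball, and in no sector since sectors are stable under
     shrinking: x lies in r D. If |x| > r, then <v, x>^2 >= |x|^4 >= r^2 |x|^2 puts x in the sector
     of v. *)
  have [xr|xr] := leP (dot x x) (r ^+ 2).
    apply: Drx; rewrite /Dr /= addr0; split.
      rewrite unit_ballE /= dotZl dotZr mulrA -expr2 exprVn.
      by rewrite ler_pdivrMl ?mulr1 // exprn_gt0.
    move=> [w wV [_ [w0 wr]]]; apply: Ax; exists w => //; split=> //.
    move: w0 wr; rewrite !dotZr dotZl pmulr_rge0 ?invr_gt0 // => w0.
    rewrite [leLHS](_ : _ = dot x x); last by field; exact: lt0r_neq0.
    by rewrite exprMn exprVn ler_pdivlMl ?exprn_gt0.
  apply: Ax; exists v => //; split=> //; rewrite (dotC v); split.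
    exact: le_trans x0 xv.
  apply: le_trans (_ : dot x x ^+ 2 <= _).
    by rewrite [leRHS]expr2 ler_wpM2r // ltW.
  by rewrite ler_pXn2r ?nnegrE // (le_trans x0).
apply: le_trans (le_vol DP).
move: vD; rewrite vDr -(fineK Dfin) -EFinM.
have : kappa R n.+1 / 2 <= fine (vol D).
  have : ((kappa R n.+1)%:E <= (fine (vol D) + kappa R n.+1 / 2)%:E)%E.
    by rewrite EFinD (fineK Dfin); apply: le_trans vB _; exact: leeD.
  by rewrite lee_fin; lra.
set m := fine (vol D) => km mD'.
have {}mD' : (((1 - r ^+ n.+1) * m)%:E <= vol (D `\` Dr))%E.
  by rewrite mulrBl mul1r EFinB leeBlDr.
by apply: le_trans mD'; rewrite lee_fin ler_wpM2l // subr_ge0 exprn_ile1 // ltW.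
Qed.

(** The chord of exp over [-1, 0] lies above the graph at -t. *)
Lemma one_sub_expR_ge (t : R) : 0 <= t -> t <= 1 ->
  (1 - expR (- 1)) * t <= 1 - expR (- t).
Proof.
move=> t0 t1.
have := convex_expR (Itv01 t0 t1) (- 1) 0.
rewrite !convRE /= expR0 mulr0 addr0 mulrN1 /unstable.onem; lra.
Qed.

(** q is the n-th root of x / y: the bound contains its square, the sector estimate its n-th
    power. *)
Lemma powR_root_prod (x y : R) n : (0 < n)%N -> 0 <= x -> 0 < y ->
  exists q, [/\ 0 <= q, q ^+ 2 = x `^ (2 / n%:R) * y `^ (- (2 / n%:R)) &
    q ^+ n = x / y].
Proof.
move=> n0 x0 y0; exists (x `^ n%:R^-1 * y `^ - n%:R^-1); split.
- by rewrite mulr_ge0 ?powR_ge0.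
- by rewrite exprMn -!powR_mulrn ?powR_ge0 // -!powRrM mulNr ![_^-1 * _]mulrC.
- rewrite exprMn -!powR_mulrn ?powR_ge0 // -!powRrM mulNr mulVf ?pnatr_eq0 -?lt0n //.
  by rewrite powRr1 // powR_inv1 // ltW.
Qed.

End missing_volume.

Theorem theorem3p1 (R : realType) (d k M : nat) (P : set 'rV[R]_d) :
  (2 <= d)%N -> (k <= d./2)%N -> (0 < M)%N ->
  polytope P -> P `<=` unit_ball d -> (faces k P #<= `I_M)%card ->
  (((1 - expR (- 1)) / 2 * kappa R d *
    Num.min 1 (d%:R / 2 *
      (omega R d / (4 * kappa R d.-1)) `^ (2 / (d%:R - 1)) *
      M%:R `^ (- (2 / (d%:R - 1)))))%:E
   <= vol (unit_ball d `\` P))%E.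
Proof.
move=> d2 kd M0 polyP PB facesP.
have e0 : 0 <= 1 - expR (- 1) :> R by rewrite subr_ge0 expR_le1; lra.
have k0 := @kappa_ge0 R d.
have [[c [b [c0 Pcb]]]|[V [VM VP PV]]] :=
    polytope_flat_or_few_vertices d2 kd polyP facesP.
  (* A flat P misses the full volume kappa_d, while (1 - 1/e) / 2 and the minimum are at most 1. *)
  apply: (@le_trans _ _ (kappa R d)%:E).
    rewrite lee_fin; set m := Num.min _ _.
    have m1 : m <= 1 by rewrite ge_min lexx.
    apply: le_trans (ler_piMr _ m1) _; first by rewrite mulr_ge0 // divr_ge0.
    by rewrite ler_piMl //; have := expR_gt0 (- 1 : R); lra.
  pose H := [set x : 'rV[R]_d | dot c x = b].
  have mH : row_measurable H.
    rewrite (_ : H = [set x | dot c x <= b] `&` [set x | b <= dot c x]).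
      by apply: row_measurableI; apply: row_measurable_le; do ?exact: measurable_cst;
        exact: row_mfun_dotr.
    apply/seteqP; split=> x /=; first by move=> ->.
    by move=> [? ?]; apply/eqP; rewrite eq_le; apply/andP.
  rewrite kappaE -[leRHS]adde0 -(vol_hyperplane b c0).
  apply: (@le_trans _ _ (vol (unit_ball d `\` H) + vol H)%E).
    apply: le_trans (volU (row_measurableD (@row_measurable_unit_ball R d) mH) mH).
    by apply: le_vol => x Bx; have [?|?] := pselect (H x); [right|left].
  by apply: leeD => //; apply: le_vol => x [Bx Hx]; split=> // /Pcb.
case: d => [|n] // in d2 kd P polyP PB facesP k0 V VM VP PV *.
have n0 : (0 < n)%N by [].
rewrite [n.+1.-1]/= (_ : n.+1%:R - 1 = n%:R) ?natr1 ?addrK //; last first.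
  by rewrite -natr1 addrK.
set X := omega R _ / _.
have X0 : 0 <= X by rewrite divr_ge0 ?mulr_ge0 ?kappa_ge0.
have M0' : 0 < M%:R :> R by rewrite ltr0n.
have [q [q0 q2 qn]] := powR_root_prod n0 X0 M0'.
rewrite -[in X in Num.min 1 X]mulrA -q2; set D : R := n.+1%:R.
have D2 : 2 <= D by rewrite ler_nat.
(* [h] is the t of the opening comment; its cap 1 / D gives the condition D (1 - r) <= 1 on
   sectors. *)
pose h := Num.min (q ^+ 2 / 2) D^-1.
have tE : Num.min 1 (D / 2 * q ^+ 2) = D * h.
  rewrite /h minr_pMr ?mulfV ?gt_eqF; try lra.
  by rewrite minC; congr Num.min; ring.
have h0 : 0 <= h by rewrite le_min invr_ge0 divr_ge0 ?sqr_ge0 //; lra.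
have hD : D * h <= 1 by rewrite -tE ge_min lexx.
have hq : 2 * h <= q ^+ 2.
  by rewrite -ler_pdivlMl // mulrC ge_min lexx.
have h1 : h <= 1 / 2 by nra.
pose r := 1 - h.
rewrite tE; apply: (@le_trans _ _ ((1 - r ^+ n.+1) * (kappa R n.+1 / 2))%:E).
  rewrite lee_fin.
  have : (1 - expR (- 1)) * (D * h) <= 1 - expR (- (D * h)).
    by apply: one_sub_expR_ge => //; rewrite mulr_ge0 //; lra.
  have pe : r ^+ n.+1 <= expR (- (D * h)).
    rewrite -mulrN mulrC expRM_natr ler_pXn2r ?nnegrE ?expR_ge0 //.
      exact: expR_ge1Dx.
    by rewrite /r; lra.
  move: k0; set K := kappa R n.+1; set E := expR (- 1) => K0.
  have : (1 - E) * (D * h) * (K / 2) <= (1 - r ^+ n.+1) * (K / 2).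
    rewrite ler_wpM2r ?divr_ge0 //; apply: (@le_trans _ _ (1 - expR (- (D * h)))).
      by apply: one_sub_expR_ge => //; rewrite mulr_ge0 //; lra.
    by rewrite lerD2l lerN2.
  by lra.
apply: vol_ball_setD_ge => //.
- by rewrite /r; lra.
- by rewrite /r; lra.
- by rewrite /r opprB addrC subrK.
- by move=> v /VP /PB; rewrite unit_ballE.
- by move=> p Pp; exact: PV.
(* 1 - r^2 = 2 h - h^2 <= 2 h <= q^2. *)
have sq : Num.sqrt (1 - r ^+ 2) <= q.
  rewrite -(ger0_norm q0) -sqrtr_sqr ler_wsqrtr // (le_trans _ hq) // /r.
  by have := sqr_ge0 h; rewrite !expr2; nra.
have sqn : Num.sqrt (1 - r ^+ 2) ^+ n <= X / M%:R.
  by rewrite -qn lerXn2r ?nnegrE ?sqrtr_ge0.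
apply: (@le_trans _ _ (M%:R * (kappa R n * (X / M%:R) * (2 / D)))).
  apply: ler_pM => //.
  - by rewrite !mulr_ge0 ?kappa_ge0 ?exprn_ge0 ?sqrtr_ge0 // invr_ge0; lra.
  - by rewrite ler_nat.
  - by rewrite ler_wpM2r ?divr_ge0 //; rewrite ler_wpM2l // kappa_ge0.
have [kn|kn] := eqVneq (kappa R n) 0; first by rewrite kn !(mul0r, mulr0) divr_ge0.
(* Once kappa_n cancels, both sides equal kappa_d / 2: the 4 in X makes M sectors fill at most half
   of the ball. *)
rewrite le_eqVlt; apply/orP; left; apply/eqP.
rewrite /X /omega /=; field.
by rewrite kn nat1r (gt_eqF M0') pnatr_eq0.
Qed.
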